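(* Let $N\ge 1$ be an integer, let $\eta>0$, let $\mathbf{x}_0\in\mathbb{R}^N$ be a fixed (deterministic) point, and let $\phi:\mathbb{R}^N\to\mathbb{R}$ be a centered Gaussian random field with continuously differentiable sample paths and covariance $\mathbb{E}[\phi(\mathbf{x})\phi(\mathbf{x}')]=\exp(-\|\mathbf{x}-\mathbf{x}'\|^2/2)$. Let $\mathbf{x}_1=\mathbf{x}_0-\eta\nabla\phi(\mathbf{x}_0)$ and $\Phi_1=\phi(\mathbf{x}_1)$. Then $$\mathbb{E}[\Phi_1]=-N\eta\left(\eta^2+1\right)^{-N/2-1}$$ and $$\mathrm{Var}(\Phi_1)=1+N\eta^2\left(1+2\eta^2\right)^{-\frac N2-2}\left(N+1-2\eta^2\right)-N^2\eta^2\left(\eta^2+1\right)^{-N-2}.$$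
   Context: The map $\mathbf{x}_0\mapsto\mathbf{x}_1$ is one step of gradient descent on $\phi$ with learning rate $\eta$. $\Phi_1$ is the same realization of the field evaluated at the random point $\mathbf{x}_1$. A version of the field with smooth sample paths exists since the covariance is smooth. *)

(* Defs.v *)
From HB Require Import structures.
From mathcomp Require Import all_boot all_order all_algebra.
From mathcomp Require Import all_classical all_reals all_analysis.
Set Implicit Arguments.
Unset Strict Implicit.
Unset Printing Implicit Defensive.
Import Order.TTheory GRing.Theory Num.Theory.
Import numFieldNormedType.Exports.
Local Open Scope classical_set_scope.
Local Open Scope ring_scope.

(* The library norm `|v| on 'rV[R]_N is the sup norm, hence this definition. *)
Definition enorm (R : realType) (N : nat) (v : 'rV[R]_N) : R :=
  Num.sqrt (\sum_(i < N) v 0 i ^+ 2).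

Definition grad (R : realType) (N : nat) (f : 'rV[R]_N -> R) (x : 'rV[R]_N) :
    'rV[R]_N :=
  \row_(i < N) 'D_(delta_mx 0 i) f x.

Definition continuously_differentiable (R : realType) (N : nat)
    (f : 'rV[R]_N -> R) : Prop :=
  (forall x, differentiable f x) /\ continuous (grad f).

(* Normal law with mean m and standard deviation s, where s = 0 gives the point
   mass at m: the library's normal_prob m 0 is the uniform law on [0, 1]. *)
Definition gaussian_law (R : realType) (m s : R) (A : set R) : \bar R :=
  if s == 0 then dirac m A else normal_prob m s A.

Definition is_gaussian (d : measure_display) (T : measurableType d)
    (R : realType) (P : probability T R) (X : T -> R) : Prop :=
  measurable_fun setT X /\
  exists m s : R, 0 <= s /\
    forall A : set R, measurable A -> P (X @^-1` A) = gaussian_law m s A.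

(* A random vector is (possibly degenerate) multivariate normal when all the
   linear combinations of its entries are univariate normal. *)
Definition gaussian_field (d : measure_display) (T : measurableType d)
    (R : realType) (P : probability T R) (I : Type)
    (phi : I -> {RV P >-> R}) : Prop :=
  forall (n : nat) (x : 'I_n -> I) (a : 'I_n -> R),
    is_gaussian P (fun w => \sum_(k < n) a k * phi (x k) w).

Arguments gaussian_field {d T R} P {I} phi.

Definition centered_field (d : measure_display) (T : measurableType d)
    (R : realType) (P : probability T R) (I : Type)
    (phi : I -> {RV P >-> R}) : Prop :=
  forall x : I, ('E_P[phi x] = 0)%E.

Arguments centered_field {d T R} P {I} phi.

Definition sample_path (d : measure_display) (T : measurableType d)
    (R : realType) (P : probability T R) (I : Type)
    (phi : I -> {RV P >-> R}) (w : T) : I -> R :=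
  fun x => phi x w.

Definition gd_step (R : realType) (N : nat) (eta : R) (f : 'rV[R]_N -> R)
    (x : 'rV[R]_N) : 'rV[R]_N :=
  x - eta *: grad f x.

(* Main.v *)
Require Import Defs.
From HB Require Import structures.
From mathcomp Require Import all_boot all_order all_algebra.
From mathcomp Require Import all_classical all_reals all_analysis.
From mathcomp Require Import measurable_realfun ring lra.
Import Order.TTheory GRing.Theory Num.Theory.
Import numFieldNormedType.Exports.
Local Open Scope classical_set_scope.
Local Open Scope ring_scope.

(** Write [G] for the gradient of the field at [x0], [k] for the Gaussian kernel
and [y c] for the point [x0 - eta c]. The variables [G i] are independent and standard
normal, and given [G] the variable [phi (y c)] is normal with mean
[m c G = - eta (c . G) k (eta c)] and variance
[v c = 1 - eta^2 |c|^2 k (eta c)^2]. Instead of conditioning, one proves that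
[cos (s phi (y c) + a) - exp (- s^2 v c / 2) cos (s m c G + a)] is orthogonal to
every trigonometric function of [G], for each deterministic [c]; this only uses
the characteristic functions of linear combinations of the field, with
derivatives replaced by finite differences. As this expression is
bounded and continuous in [c], one may then substitute [c := G] by approximating
with trigonometric polynomials, which gives the characteristic function of
[phi (x1)] as the mean of [exp (- s^2 v G / 2) exp (i s m G G)]. Letting [s] tend
to 0, the moments of [phi (x1)] are those of a function of [Q = |G|^2], and these
are read off the derivatives of [E exp (- a Q / 2) = (1 + a)^(- N / 2)]. *)

Set Implicit Arguments.
Unset Strict Implicit.
Unset Printing Implicit Defensive.

(** The field is evaluated at a random point, whereas [gaussian_field] speaks of deterministic
    points only, so the law of [phi (x1)], and even its measurability, have to be derived.
    Orthogonality to all trigonometric functions of [G] is the invariant that makes this possible: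
    multiplying by such a function preserves it, and these functions are the ones that approximate
    the substitution. Complex exponentials are replaced by [cos (_ + th)] with a free phase:
    [th = 0] and [th = - pi / 2] give cosine and sine, and a product of two cosines is again a
    combination of such cosines. The covariance of [phi y] with [G i] is [(y - x0)_i k (y - x0)],
    and that of [G] is minus the Hessian of [k] at 0, the identity; this yields [m] and [v]. At
    [c = G] the mean contains [exp (- eta^2 Q / 2)], while its square and the variance contain
    [exp (- eta^2 Q)]. The Laplace transform of [Q] is thus differentiated at [eta^2] for the
    expectation and at [2 eta^2] for the second moment, whence the two bases [eta^2 + 1] and
    [1 + 2 eta^2]. *)

Section bounded_functions.
Context d (T : measurableType d) (R : realType).
Implicit Types f g : T -> R.

(** This class is closed under sums, products and trigonometric functions, so that integrability for
    a finite measure is automatic and a constant dominates in passages to the limit. *)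
Definition bounded_mfun f :=
  measurable_fun setT f /\ exists M : R, forall w, `|f w| <= M.

Lemma bounded_mfun_cst (c : R) : bounded_mfun (fun=> c).
Proof. by split; [exact: measurable_cst|exists `|c|]. Qed.

Lemma bounded_mfunD f g :
  bounded_mfun f -> bounded_mfun g -> bounded_mfun (fun w => f w + g w).
Proof.
move=> [mf [M Mf]] [mg [K Kg]]; split; first exact: measurable_funD.
by exists (M + K) => w; rewrite (le_trans (ler_normD _ _))// lerD.
Qed.

Lemma bounded_mfunM f g :
  bounded_mfun f -> bounded_mfun g -> bounded_mfun (fun w => f w * g w).
Proof.
move=> [mf [M Mf]] [mg [K Kg]]; split; first exact: measurable_funM.
by exists (M * K) => w; rewrite normrM ler_pM.
Qed.

Lemma bounded_mfunN f : bounded_mfun f -> bounded_mfun (fun w => - f w).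
Proof.
move=> [mf [M Mf]]; split; first exact: measurableT_comp.
by exists M => w; rewrite normrN.
Qed.

Lemma bounded_mfunB f g :
  bounded_mfun f -> bounded_mfun g -> bounded_mfun (fun w => f w - g w).
Proof. by move=> bf bg; apply: bounded_mfunD => //; exact: bounded_mfunN. Qed.

Lemma bounded_mfun_cos f : measurable_fun setT f -> bounded_mfun (fun w => cos (f w)).
Proof.
move=> mf; split; last by exists 1 => w; exact: cos_max.
apply: measurableT_comp => //; apply: continuous_measurable_fun.
exact: continuous_cos.
Qed.

Lemma bounded_mfun_sin f : measurable_fun setT f -> bounded_mfun (fun w => sin (f w)).
Proof.
move=> mf; split; last by exists 1 => w; exact: sin_max.
apply: measurableT_comp => //; apply: continuous_measurable_fun.
exact: continuous_sin.
Qed.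

Lemma bounded_mfun_expRN f : measurable_fun setT f -> (forall w, 0 <= f w) ->
  bounded_mfun (fun w => expR (- f w)).
Proof.
move=> mf f0; split.
  by apply: measurableT_comp => //; exact: measurableT_comp.
exists 1 => w; rewrite ger0_norm ?expR_ge0// -expR0 ler_expR.
by rewrite oppr_le0.
Qed.

Lemma bounded_mfun_integrable (mu : {finite_measure set T -> \bar R}) f :
  bounded_mfun f -> mu.-integrable setT (EFin \o f).
Proof.
move=> [mf [M Mf]]; apply: measurable_bounded_integrable => //.
  by rewrite -ge0_fin_numE// fin_num_measure.
exists M; split; first exact: num_real.
by move=> x Mx w _ /=; rewrite (le_trans (Mf w))// ltW.
Qed.

Lemma bounded_cvg_Rintegral (mu : {finite_measure set T -> \bar R})
    (f_ : nat -> T -> R) f (M : R) :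
  (forall n, measurable_fun setT (f_ n)) -> (forall n w, `|f_ n w| <= M) ->
  (forall w, f_ n w @[n --> \oo] --> f w) ->
  \int[mu]_w f_ n w @[n --> \oo] --> \int[mu]_w f w.
Proof.
move=> mf Mf ff.
have iM : mu.-integrable setT (EFin \o cst M).
  by apply: bounded_mfun_integrable; exact: bounded_mfun_cst.
have mff : measurable_fun setT f.
  by apply: measurable_fun_cvg => // w _; exact: ff.
have [//|||||fi _] := @dominated_convergence _ _ _ mu _ measurableT
   (fun n => EFin \o f_ n) (EFin \o f) (EFin \o cst M).
- by move=> n; exact/measurable_EFinP.
- exact/measurable_EFinP.
- by apply: aeW => w _; apply: cvg_EFin; [exact: nearW|exact: ff].
- by [].
- by apply: aeW => w n _; rewrite lee_fin.
move=> /= h; apply: fine_cvg; rewrite fineK//.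
exact: integrable_fin_num.
Qed.

End bounded_functions.

(** * Limits along the sequence [1 / n.+1] *)

Lemma cvg_exprn (R : realType) (I : Type) (F : set_system I) {FF : Filter F}
    (f : I -> R) (a : R) (n : nat) :
  f x @[x --> F] --> a -> f x ^+ n @[x --> F] --> a ^+ n.
Proof. move=> h; exact: (cvg_comp f _ h (@exprn_continuous R n a)). Qed.

Lemma cvg_sum_filter (R : realType) (J I : Type) (F : set_system J) {FF : Filter F}
    (s : seq I) (f : I -> J -> R) (l : I -> R) :
  (forall i, f i x @[x --> F] --> l i) ->
  \sum_(i <- s) f i x @[x --> F] --> \sum_(i <- s) l i.
Proof.
move=> fl; elim: s => [|i s ih].
  rewrite big_nil (_ : (fun n => _) = (fun=> 0)); first exact: cvg_cst.
  by apply/funext => n; rewrite big_nil.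
rewrite big_cons (_ : (fun n => _) = (fun n => f i n + \sum_(i <- s) f i n)).
  by apply: cvgD.
by apply/funext => n; rewrite big_cons.
Qed.

Lemma cvg_harmonic_sqr (R : realType) :
  (n.+1%:R ^+ 2)^-1 @[n --> \oo] --> (0 : R).
Proof.
rewrite [X in _ --> X](_ : _ = 0 ^+ 2); last by rewrite expr0n.
rewrite (_ : (fun n => _) = (fun n => n.+1%:R^-1 ^+ 2)).
  by apply: cvg_exprn; exact: cvg_harmonic.
by apply/funext => n; rewrite exprVn.
Qed.

(** Derivatives are taken along a sequence because measurability of limits and dominated convergence
    are applied to sequences. *)
Lemma cvg_harmonic_quotient (R : realType) (V : normedModType R) (f : V -> R)
    (a v : V) (l : R) : is_derive a v f l ->
  n.+1%:R * (f (n.+1%:R^-1 *: v + a) - f a) @[n --> \oo] --> l.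
Proof.
move=> [df <-].
have h : h^-1 *: ((f \o shift a) (h *: v) - f a) @[h --> 0^'] --> 'D_v f a.
  exact: df.
move/cvgr_dnbhsP : h => /(_ (fun n => n.+1%:R^-1)) /= h.
rewrite (_ : (fun n => _) = (fun n => n.+1%:R^-1^-1 *:
    (f (n.+1%:R^-1 *: v + a) - f a))); last first.
  by apply/funext => n; rewrite invrK.
by apply: h; split => [n|]; [rewrite invr_eq0|exact: cvg_harmonic].
Qed.

Lemma cvg_harmonic_quotient1 (R : realType) (f : R -> R) (a x l : R) :
  is_derive a 1 f l ->
  n.+1%:R * (f (x / n.+1%:R + a) - f a) @[n --> \oo] --> x * l.
Proof.
move=> [df <-].
(* The increments [x / n.+1%:R] must avoid 0 to lie in the punctured neighbourhood, so [x = 0] is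
   treated apart. *)
have [->|x0] := eqVneq x 0.
  rewrite (_ : (fun n => _) = (fun=> 0)); first by rewrite mul0r; exact: cvg_cst.
  by apply/funext => n; rewrite mul0r add0r subrr mulr0.
have h : h^-1 *: ((f \o shift a) (h *: 1) - f a) @[h --> 0^'] --> 'D_1 f a.
  exact: df.
move/cvgr_dnbhsP : h => /(_ (fun n => x / n.+1%:R)) /= h.
rewrite (_ : (fun n => _) = (fun n => x * ((x / n.+1%:R)^-1 *:
    (f ((x / n.+1%:R) *: 1 + a) - f a)))); last first.
  apply/funext => n; rewrite /GRing.scale/= mulr1 invf_div mulrA; congr (_ * _).
  by rewrite mulrCA divff// mulr1.
apply: cvgMl_tmp; apply: h; split => [n|].
  by rewrite mulf_neq0// invr_eq0.
by rewrite -[X in _ --> X](mulr0 x); apply: cvgMl_tmp; exact: cvg_harmonic.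
Qed.

(** * Recovering the first two moments from the characteristic function *)

Section moments_of_charfun.
Context (R : realType).

Lemma norm_sin_le (x : R) : `|sin x| <= `|x|.
Proof.
wlog x0 : x / 0 <= x => [h|].
  have [|x0] := leP 0 x; first exact: h.
  by rewrite -normrN -sinN -(normrN x) h// oppr_ge0 ltW.
move: x0; rewrite le_eqVlt => /predU1P[<-|x0]; first by rewrite sin0.
have [|c _] := @MVT _ (@sin R) cos _ _ x0.
  by apply: continuous_subspaceT => y; exact: continuous_sin.
rewrite sin0 !subr0 => ->.
by rewrite normrM ler_piMl// cos_max.
Qed.

Lemma cvg_sin_harmonic (x : R) : n.+1%:R * sin (x / n.+1%:R) @[n --> \oo] --> x.
Proof.
have := @cvg_harmonic_quotient1 _ _ _ x _ (is_derive_sin (0 : R)).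
rewrite cos0 mulr1; under eq_fun do rewrite addr0 sin0 subr0.
exact.
Qed.

(** The half-angle formula [1 - cos (2 u) = 2 sin^2 u] reduces this to the limit of
    [n sin (x / n)]. *)
Lemma cvg_1Bcos_harmonic (x : R) :
  2 * n.+1%:R ^+ 2 * (1 - cos (x / n.+1%:R)) @[n --> \oo] --> x ^+ 2.
Proof.
rewrite (_ : (fun n => _) = (fun n => (n.+1%:R * sin (x / 2 / n.+1%:R)) ^+ 2 * 4)); last first.
  apply/funext => n.
  have -> : x / n.+1%:R = (x / 2 / n.+1%:R) *+ 2 :> R by field; rewrite lt0r_neq0.
  by rewrite cos_mulr2n cos2sin2; ring.
rewrite (_ : x ^+ 2 = (x / 2) ^+ 2 * 4); last by field.
apply: cvgMr_tmp; apply: cvg_exprn.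
exact: cvg_sin_harmonic.
Qed.

(** The approximations of [x ^+ 2] lie below their limit: this gives the positivity needed for
    Fatou's lemma and the domination needed afterwards. *)
Lemma le_1Bcos_harmonic (x : R) (n : nat) :
  0 <= 2 * n.+1%:R ^+ 2 * (1 - cos (x / n.+1%:R)) <= x ^+ 2.
Proof.
have -> : x / n.+1%:R = (x / 2 / n.+1%:R) *+ 2 :> R by field; rewrite lt0r_neq0.
rewrite cos_mulr2n cos2sin2.
have := norm_sin_le (x / 2 / n.+1%:R).
rewrite -ler_sqr ?nnegrE// !real_normK ?num_real// => h.
rewrite (_ : 2 * _ * _ = 4 * n.+1%:R ^+ 2 * sin (x / 2 / n.+1%:R) ^+ 2); last by ring.
rewrite mulr_ge0 ?sqr_ge0 ?mulr_ge0//= (le_trans (ler_wpM2l (_ : 0 <= 4 * n.+1%:R ^+ 2) h))//.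
by rewrite le_eqVlt; apply/orP; left; apply/eqP; field; rewrite lt0r_neq0.
Qed.

(** A squeeze by [u - u^2 <= 1 - exp (- u) <= u] at [u = a / n.+1%:R ^+ 2]. *)
Lemma cvg_1BexpR_harmonic (a : R) : 0 <= a ->
  n.+1%:R ^+ 2 * (1 - expR (- (a / n.+1%:R ^+ 2))) @[n --> \oo] --> a.
Proof.
move=> a0.
apply: (@squeeze_cvgr _ _ _ R (fun n => a - a ^+ 2 * (n.+1%:R ^+ 2)^-1) (fun=> a)).
- apply: nearW => n.
  have n0 : 0 < n.+1%:R ^+ 2 :> R by rewrite exprn_gt0.
  have : 0 <= a / n.+1%:R ^+ 2 by rewrite divr_ge0// ltW.
  rewrite [X in X - _ <= _ <= X](_ : a = n.+1%:R ^+ 2 * (a / n.+1%:R ^+ 2)); last first.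
    by rewrite mulrCA divff ?gt_eqF// mulr1.
  rewrite (_ : a ^+ 2 * _ = n.+1%:R ^+ 2 * (a / n.+1%:R ^+ 2) ^+ 2); last first.
    by field; rewrite lt0r_neq0.
  set u := a / _ => u0.
  rewrite -mulrBr !ler_pM2l//; apply/andP; split; last first.
    by have := expR_ge1Dx (- u); lra.
  have h1 : (1 + u) * expR (- u) <= 1.
    by rewrite expRN -ler_pdivlMr ?invr_gt0 ?expR_gt0// invrK mul1r expR_ge1Dx.
  have h2 : (1 + u) * (1 - u + u ^+ 2) = 1 + u ^+ 3 by ring.
  have u3 : 0 <= u ^+ 3 by rewrite exprn_ge0.
  suff : expR (- u) <= 1 - u + u ^+ 2 by lra.
  by rewrite -(ler_pM2l (_ : 0 < 1 + u)); lra.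
- rewrite -[X in _ --> X]subr0; apply: cvgB; first exact: cvg_cst.
  rewrite -[X in _ --> X](mulr0 (a ^+ 2)); apply: cvgMl_tmp.
  exact: cvg_harmonic_sqr.
- exact: cvg_cst.
Qed.

Context d (T : measurableType d) (P : probability T R).

Lemma Rintegral_prob_cst (c : R) : \int[P]_w c = c.
Proof.
by rewrite /Rintegral integral_cst// [X in (_ * X)%E]probability_setT mule1.
Qed.

(** Integrability of [X ^+ 2] is a conclusion: Fatou's lemma bounds its integral by [v], after which
    [X ^+ 2] itself dominates the approximations and the limit can be exchanged with the
    integral. *)
Lemma moment2_charfun (X : T -> R) (v : R) : measurable_fun setT X ->
  2 * n.+1%:R ^+ 2 * (1 - \int[P]_w cos (X w / n.+1%:R)) @[n --> \oo] --> v ->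
  P.-integrable setT (fun w => (X w ^+ 2)%:E) /\ \int[P]_w (X w ^+ 2) = v.
Proof.
move=> mX hv.
pose g n w : R := 2 * n.+1%:R ^+ 2 * (1 - cos (X w / n.+1%:R)).
have mc n : bounded_mfun (fun w => cos (X w / n.+1%:R)).
  by apply: bounded_mfun_cos; exact: measurable_funM.
have bg n : bounded_mfun (g n).
  apply: bounded_mfunM; first exact: bounded_mfun_cst.
  by apply: bounded_mfunB => //; exact: bounded_mfun_cst.
have mg n : measurable_fun setT (EFin \o g n) by apply/measurable_EFinP; case: (bg n).
have mX2 : measurable_fun setT (fun w => (X w ^+ 2)%:E).
  by apply/measurable_EFinP; exact: measurable_funX.
have Ig n : \int[P]_w g n w = 2 * n.+1%:R ^+ 2 * (1 - \int[P]_w cos (X w / n.+1%:R)).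
  rewrite RintegralZl//=; last first.
    apply: bounded_mfun_integrable; apply: bounded_mfunB => //.
    exact: bounded_mfun_cst.
  rewrite RintegralB//=; [|exact/bounded_mfun_integrable/bounded_mfun_cst
                          |exact: bounded_mfun_integrable].
  by rewrite Rintegral_prob_cst.
have Igv : \int[P]_w g n w @[n --> \oo] --> v by under eq_fun do rewrite Ig.
have gX w : (g n w)%:E @[n --> \oo] --> (X w ^+ 2)%:E.
  by apply: cvg_EFin; [exact: nearW|exact: cvg_1Bcos_harmonic].
have Ev : (\int[P]_w (g n w)%:E)%E @[n --> \oo] --> v%:E.
  rewrite (_ : (fun n => _) = EFin \o (fun n => \int[P]_w g n w)).
    by apply: cvg_EFin => //; exact: nearW.
  apply/funext => n /=; rewrite fineK//.
  by apply: integrable_fin_num => //; exact: bounded_mfun_integrable.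
have iX : P.-integrable setT (fun w => (X w ^+ 2)%:E).
  apply/integrableP; split => //.
  have := @fatou _ _ _ P _ measurableT (fun n => EFin \o g n) mg.
  rewrite (is_cvg_limn_einfE (cvgP _ Ev)) (cvg_lim _ Ev)//.
  move=> /(_ _)/wrap[|h].
    by move=> n w _; rewrite lee_fin; have /andP[] := le_1Bcos_harmonic (X w) n.
  apply: le_lt_trans (ltry v); apply: le_trans h; rewrite le_eqVlt; apply/orP; left.
  apply/eqP/eq_integral => w _.
  rewrite (is_cvg_limn_einfE (cvgP _ (gX w))) (cvg_lim _ (gX w))//.
  by rewrite gee0_abs// lee_fin sqr_ge0.
split => //.
have [//|||||_ _] := @dominated_convergence _ _ _ P _ measurableT
   (fun n => EFin \o g n) (fun w => (X w ^+ 2)%:E) (fun w => (X w ^+ 2)%:E).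
- by [].
- by apply: aeW => w _; exact: gX.
- by [].
- apply: aeW => w n _; have /andP[g0 gx] := le_1Bcos_harmonic (X w) n.
  by rewrite lee_fin ger0_norm.
move=> /(cvg_unique _ Ev) => h.
by rewrite /Rintegral -h.
Qed.

(** Since [|sin u| <= |u|], the functions [n sin (X / n)] are dominated by [|X|], here assumed
    integrable. *)
Lemma moment1_charfun (X : T -> R) (m : R) : measurable_fun setT X ->
  P.-integrable setT (EFin \o X) ->
  n.+1%:R * \int[P]_w sin (X w / n.+1%:R) @[n --> \oo] --> m ->
  \int[P]_w X w = m.
Proof.
move=> mX iX hm.
pose g n w : R := n.+1%:R * sin (X w / n.+1%:R).
have bg n : bounded_mfun (g n).
  apply: bounded_mfunM; first exact: bounded_mfun_cst.
  by apply: bounded_mfun_sin; exact: measurable_funM.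
have [//|||||_ _] := @dominated_convergence _ _ _ P _ measurableT
   (fun n => EFin \o g n) (EFin \o X) (fun w => `|(X w)%:E|)%E.
- by move=> n; apply/measurable_EFinP; case: (bg n).
- exact/measurable_EFinP.
- by apply: aeW => w _; apply: cvg_EFin; [exact: nearW|exact: cvg_sin_harmonic].
- exact: integrable_abse.
- apply: aeW => w n _; rewrite lee_fin /g normrM ger0_norm//.
  rewrite (le_trans (ler_wpM2l _ (norm_sin_le _)))//.
  by rewrite normrM normfV mulrCA (@ger0_norm _ n.+1%:R)// divff// mulr1.
move=> h.
suff : \int[P]_w g n w @[n --> \oo] --> \int[P]_w X w.
  under eq_fun => n.
    rewrite RintegralZl//=; last first.
      apply: bounded_mfun_integrable; apply: bounded_mfun_sin.
      exact: measurable_funM.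
    over.
  by move=> /(cvg_unique _ hm) ->.
apply: fine_cvg; rewrite fineK//; exact: integrable_fin_num.
Qed.

End moments_of_charfun.

(** * Characteristic function of the normal density, by Stein's identity *)

Section normal_charfun.
Context (R : realType).
Local Notation mu := (@lebesgue_measure R).

(** The fundamental theorem of calculus on [[- n.+1, n.+1]], then dominated convergence by [|f|]. It
    replaces integration by parts on the whole line. *)
Lemma Rintegral_derive_vanishing (F f : R -> R) :
  (forall x : R, is_derive x 1 F (f x)) -> continuous f ->
  mu.-integrable setT (EFin \o f) ->
  F n.+1%:R @[n --> \oo] --> 0 -> F (- n.+1%:R) @[n --> \oo] --> 0 ->
  \int[mu]_x f x = 0.
Proof.
move=> Ff cf intf Fp Fm.
pose D n : set R := `[- n.+1%:R, n.+1%:R]%classic.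
pose g n := f \_ (D n).
have mf : measurable_fun setT f by exact: continuous_measurable_fun.
have gE n : (\int[mu]_x (g n x)%:E)%E = (F n.+1%:R - F (- n.+1%:R))%:E.
  transitivity (\int[mu]_(x in D n) (f x)%:E)%E.
    rewrite [RHS]integral_mkcond; apply: eq_integral => x _.
    by rewrite /g !patchE; case: ifP.
  rewrite (continuous_FTC2 (F := F))//.
  - by rewrite ltrNl (@lt_trans _ _ 0)// oppr_lt0.
  - exact: continuous_subspaceT.
  - have dF x : derivable F x 1 by have [] := Ff x.
    have cF : continuous F.
      by move=> x; apply: differentiable_continuous; exact/derivable1_diffP.
    split => //; [exact/cvg_at_right_filter/cF|exact/cvg_at_left_filter/cF].
  - by move=> x _; rewrite derive1E; have [] := Ff x.
have [//|||||_ _] := @dominated_convergence _ _ _ mu _ measurableT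
   (fun n => EFin \o g n) (EFin \o f) (fun w => `|(f w)%:E|)%E.
- move=> n; apply/measurable_EFinP; rewrite /g.
  apply: (iffLR (measurable_restrictT f _)); first exact: measurable_itv.
  exact: measurable_funTS.
- exact/measurable_EFinP.
- apply: aeW => x _; apply: cvg_EFin; first exact: nearW.
  have : \forall n \near \oo, f x = g n x.
    near=> n; rewrite /g patchE mem_set// /D/= in_itv/= -ler_norml.
    rewrite (@le_trans _ _ n%:R)//; last by rewrite ler_nat.
    by near: n; exact: nbhs_infty_ger.
  by move/near_eq_cvg => h; apply: cvg_trans h _; exact: cvg_cst.
- exact: integrable_abse.
- apply: aeW => x n _; rewrite lee_fin /g patchE; case: ifP => // _.
  by rewrite normr0.
rewrite /=; under eq_fun do rewrite gE.
have h : (F n.+1%:R - F (- n.+1%:R))%:E @[n --> \oo] --> 0%:E.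
  apply: cvg_EFin; first exact: nearW.
  by rewrite -[X in _ --> X](subr0 0); apply: cvgB.
by move=> /(cvg_unique _ h) h'; rewrite /Rintegral -h'.
Unshelve. all: by end_near. Qed.

Variables (m s : R).
Hypothesis s_neq0 : s != 0.
Local Notation p := (normal_pdf m s).

Let s2 : 0 < s ^+ 2. Proof. by rewrite exprn_even_gt0. Qed.

Lemma is_derive_normal_pdf (x : R) : is_derive x 1 p (- ((x - m) / s ^+ 2) * p x).
Proof.
rewrite normal_pdfE//.
rewrite /normal_fun.
have h : is_derive x 1 (fun u : R => - (u - m) ^+ 2 / (s ^+ 2 *+ 2)) (- ((x - m) / s ^+ 2)).
  by apply: is_derive_eq; rewrite /GRing.scale/= -(mulr_natr (s ^+ 2)); field.
have h2 := is_derive1_comp (is_derive_expR _) h.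
have h3 : is_derive x 1 (fun=> normal_peak s) 0 by exact: is_derive_cst.
by apply: is_derive_eq; rewrite /GRing.scale/=; ring.
Qed.

(** The sign [e] covers both ends of the line at once. *)
Lemma cvg_normal_pdf_sgn (e : R) : e ^+ 2 = 1 ->
  p (e * n.+1%:R) @[n --> \oo] --> 0.
Proof.
move=> e1; rewrite normal_pdfE//= -(mulr0 (normal_peak s)).
apply: cvgMl_tmp; rewrite /normal_fun.
under eq_fun do rewrite mulNr.
apply: (cvg_comp (fun n => (e * n.+1%:R - m) ^+ 2 / (s ^+ 2 *+ 2)) (fun x => expR (- x)));
  last exact: cvgr_expR.
apply/cvgryPge => A; near=> n.
rewrite ler_pdivlMr ?pmulrn_lgt0//.
(* The bound in use is [(u - m)^2 >= u^2 / 2 - m^2] at [u = e * n.+1%:R], which follows from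
   [(u - 2 m)^2 >= 0]. *)
have : (m ^+ 2 + A * (s ^+ 2 *+ 2)) * 2 <= n%:R by near: n; exact: nbhs_infty_ger.
have : n%:R <= n.+1%:R ^+ 2 :> R.
  by rewrite -natrX ler_nat (leq_trans (leqnSn n))// leq_pmulr.
have : 0 <= (e * n.+1%:R - 2 * m) ^+ 2 by exact: sqr_ge0.
rewrite !sqrrB !exprMn e1.
nra.
Unshelve. all: by end_near. Qed.

(** The dominating function is a multiple of the density with doubled variance. With [v = x - m] and
    [E = exp (- v^2 / (4 s^2))], the density at [x] is proportional to [E^2]. One factor [E] absorbs
    [|v| <= 1 + v^2] at the cost of [1 + 4 s^2]; the other is the wider density up to the ratio of
    the peaks. *)
Lemma integrable_normal_mean :
  mu.-integrable setT (fun x => (`|x - m| * p x)%:E).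
Proof.
pose s' := Num.sqrt 2 * s.
have s'0 : s' != 0 by rewrite mulf_neq0// gt_eqF.
pose K := (1 + 4 * s ^+ 2) * (normal_peak s / normal_peak s').
have iK : mu.-integrable setT (fun x => (K * normal_pdf m s' x)%:E).
  by under eq_fun do rewrite EFinM; apply: integrableZl => //; exact: integrable_normal_pdf.
apply: le_integrable iK => //.
  apply/measurable_EFinP; apply: measurable_funM => //; last exact: measurable_normal_pdf.
  by apply: measurableT_comp => //; exact: measurable_funB.
move=> x _; rewrite lee_fin.
rewrite ger0_norm; last by rewrite mulr_ge0// normal_pdf_ge0.
rewrite ger0_norm; last first.
  rewrite mulr_ge0 ?normal_pdf_ge0// mulr_ge0 ?divr_ge0 ?normal_peak_ge0//.
  by rewrite addr_ge0// mulr_ge0// ltW.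
rewrite !normal_pdfE// /K.
rewrite /normal_fun /s' exprMn sqr_sqrtr//.
set v := x - m.
rewrite (_ : - v ^+ 2 / (s ^+ 2 *+ 2) = - (v ^+ 2 / (4 * s ^+ 2)) + - (v ^+ 2 / (4 * s ^+ 2))); last first.
  by rewrite -(mulr_natr (s ^+ 2)); field.
rewrite (_ : - v ^+ 2 / (2 * s ^+ 2 *+ 2) = - (v ^+ 2 / (4 * s ^+ 2))); last first.
  by rewrite -(mulr_natr (2 * s ^+ 2)); field.
rewrite expRD; set E := expR _.
have E0 : 0 < E by exact: expR_gt0.
have E1 : E <= 1.
  rewrite -expR0 ler_expR oppr_le0 divr_ge0 ?sqr_ge0//.
  by rewrite pmulr_lge0 ?ltW.
have vE : (1 + v ^+ 2 / (4 * s ^+ 2)) * E <= 1.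
  rewrite -[leRHS](@mulVf _ E) ?gt_eqF// ler_wpM2r ?(ltW E0)// /E expRN invrK.
  exact: expR_ge1Dx.
have vE2 : v ^+ 2 * E <= 4 * s ^+ 2.
  have s4 : 0 < 4 * s ^+ 2 by rewrite mulr_gt0.
  rewrite -(ler_pM2l (_ : 0 < (4 * s ^+ 2)^-1)) ?invr_gt0// mulVf ?gt_eqF//.
  by rewrite mulrCA mulrA; lra.
have vv : `|v| <= 1 + v ^+ 2.
  by have := sqr_ge0 (`|v| - 1); rewrite sqrrB1 real_normK ?num_real//; have := normr_ge0 v; lra.
have pk : 0 < normal_peak s' by exact: normal_peak_gt0.
rewrite -/s' (_ : (1 + _) * _ * _ = (1 + 4 * s ^+ 2) * (normal_peak s * E)); last first.
  by rewrite -mulrA mulrACA [in LHS]mulrA; field; rewrite gt_eqF.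
rewrite (_ : `|v| * _ = `|v| * E * (normal_peak s * E)); last by ring.
rewrite ler_wpM2r ?mulr_ge0 ?normal_peak_ge0 ?(ltW E0)//.
rewrite (le_trans (ler_wpM2r (ltW E0) vv))// mulrDl mul1r lerD//.
Qed.

Lemma integrable_bounded_normal (f : R -> R) : bounded_mfun f ->
  mu.-integrable setT (fun x => (f x * p x)%:E).
Proof.
move=> [mf [M Mf]].
have iK : mu.-integrable setT (fun x => (M * p x)%:E).
  by under eq_fun do rewrite EFinM; apply: integrableZl => //; exact: integrable_normal_pdf.
apply: le_integrable iK => //.
  by apply/measurable_EFinP; apply: measurable_funM => //; exact: measurable_normal_pdf.
move=> x _; rewrite lee_fin !normrM ler_wpM2r//.
by rewrite (le_trans (Mf x))// ler_norm.
Qed.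

Lemma integrable_mean_normal (f : R -> R) : bounded_mfun f ->
  mu.-integrable setT (fun x => ((x - m) * f x * p x)%:E).
Proof.
move=> [mf [M Mf]].
have iK : mu.-integrable setT (fun x => (M * (`|x - m| * p x))%:E).
  by under eq_fun do rewrite EFinM; apply: integrableZl => //; exact: integrable_normal_mean.
apply: le_integrable iK => //.
  apply/measurable_EFinP; apply: measurable_funM => //; last exact: measurable_normal_pdf.
  by apply: measurable_funM => //; exact: measurable_funB.
move=> x _; rewrite lee_fin !normrM normr_id (mulrC `|x - m|) -mulrA.
by rewrite ler_wpM2r ?mulr_ge0// (le_trans (Mf x))// ler_norm.
Qed.

(** The derivative of [f * p] is [f1 * p - (x - m) f p / s^2], and [f * p] vanishes at both ends of
    the line. *)
Lemma stein_normal (f f1 : R -> R) : bounded_mfun f -> bounded_mfun f1 ->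
  (forall x : R, is_derive x 1 f (f1 x)) -> continuous f1 ->
  \int[mu]_x ((x - m) * f x * p x) = s ^+ 2 * \int[mu]_x (f1 x * p x).
Proof.
move=> bf bf1 df cf1.
have cp : continuous p by exact: continuous_normal_pdf.
have cf : continuous f.
  move=> x; apply: differentiable_continuous; apply/derivable1_diffP.
  by have [] := df x.
have Fe e : e ^+ 2 = 1 -> f (e * n.+1%:R) * p (e * n.+1%:R) @[n --> \oo] --> (0:R).
  move=> e1; have [M Mf] := bf.2.
  apply: norm_cvg0.
  apply: (@squeeze_cvgr _ _ _ R (fun=> 0) (fun n : nat => M * p (e * n.+1%:R))).

  - apply: nearW => n; rewrite normr_ge0/= normrM.
    by rewrite (ger0_norm (normal_pdf_ge0 _ _ _)) ler_wpM2r// normal_pdf_ge0.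
  - exact: cvg_cst.
  - by rewrite -(mulr0 M); apply: cvgMl_tmp; exact: cvg_normal_pdf_sgn.
have := @Rintegral_derive_vanishing (fun x => f x * p x)
  (fun x => f1 x * p x - (s ^+ 2)^-1 * ((x - m) * f x * p x)).
have i1 := integrable_bounded_normal bf1.
have i2 := integrable_mean_normal bf.
have i3 : mu.-integrable setT (fun x => ((s ^+ 2)^-1 * ((x - m) * f x * p x))%:E).
  by under eq_fun do rewrite EFinM; exact: integrableZl.
rewrite RintegralB// RintegralZl// => h.
apply: (mulfI (invr_neq0 (lt0r_neq0 s2))); rewrite mulKf ?gt_eqF//.
apply/esym/eqP; rewrite -subr_eq0; apply/eqP; apply: h.
- move=> x; have := is_derive_normal_pdf x; have := df x => d1 d2.
  by apply: is_derive_eq; rewrite /GRing.scale/=; ring.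
- move=> x; apply: cvgB; first by apply: cvgM; [exact: cf1|exact: cp].
  apply: cvgMl_tmp; apply: cvgM; last exact: cp.
  by apply: cvgM; [apply: cvgB; [exact: cvg_id|exact: cvg_cst]|exact: cf].
- by under [X in _.-integrable _ X]eq_fun do rewrite /= EFinB; exact: integrableB.
- by have := Fe 1; rewrite expr1n; under eq_fun do rewrite mul1r; exact.
- by have := Fe (-1); rewrite sqrrN expr1n; under eq_fun do rewrite mulN1r; exact.
Qed.

(** Differentiating the integral [C] in [t] produces a factor [x - m], which Stein's identity turns
    into [C' = - s^2 t C]; hence [C t * exp (s^2 t^2 / 2)] is constant, equal to its value [cos th]
    at 0. *)
Lemma charfun_normal_pdf (t th : R) :
  \int[mu]_x (cos (t * (x - m) + th) * p x) =
  cos th * expR (- (s ^+ 2 * t ^+ 2 / 2)).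
Proof.
pose f (t x : R) := cos (t * (x - m) + th) * p x.
pose C t := \int[mu]_x f t x.
have mlin t' : measurable_fun setT (fun x : R => t' * (x - m) + th).
  by apply: measurable_funD => //; apply: measurable_funM => //; exact: measurable_funB.
have dlin (t' x : R) : is_derive t' 1 (fun u => u * (x - m) + th) (x - m).
  by apply: is_derive_eq; rewrite /GRing.scale/=; ring.
have df (t' x : R) : is_derive t' 1 (f ^~ x) (- ((x - m) * sin (t' * (x - m) + th) * p x)).
  have h := is_derive1_comp (is_derive_cos _) (dlin t' x).
  have h3 : is_derive t' 1 (fun=> p x) 0 by exact: is_derive_cst.
  rewrite /f; apply: is_derive_eq; rewrite /GRing.scale/=; ring.
have d1f (t' x : R) : partial1of2 f t' x = - ((x - m) * sin (t' * (x - m) + th) * p x).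
  by rewrite partial1of2E; have [] := df t' x.
have dC (t' : R) : is_derive t' 1 C (- (s ^+ 2 * t' * C t')).
  have I : `](t' - 1), (t' + 1)[%classic t' by rewrite /= in_itv/= gtrBl ltrDl ltr01.
  have i1 (u : R) : `](t' - 1), (t' + 1)[%classic u -> mu.-integrable setT (EFin \o f u).
    by move=> _; apply: integrable_bounded_normal; exact: bounded_mfun_cos.
  have i2 (u y : R) : `](t' - 1), (t' + 1)[%classic u -> setT y -> derivable (f ^~ y) u 1.
    by move=> _ _; have [] := df u y.
  have i3 (u y : R) : `](t' - 1), (t' + 1)[%classic u -> setT y ->
      `|partial1of2 f u y| <= `|y - m| * p y.
    move=> _ _; rewrite d1f normrN !normrM (ger0_norm (normal_pdf_ge0 _ _ _)).
    by rewrite ler_wpM2r ?normal_pdf_ge0// ler_piMr// sin_max.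
  have p0 y : 0 <= `|y - m| * p y by rewrite mulr_ge0// normal_pdf_ge0.
  have D1 := @derivable_under_integral _ _ _ mu f setT measurableT t' _ _ I i1 i2
    _ p0 integrable_normal_mean i3.
  have D2 := @differentiation_under_integral _ _ _ mu f setT measurableT t' _ _ I i1 i2
    _ p0 integrable_normal_mean i3.
  apply: DeriveDef => //; rewrite -derive1E D2.
  under eq_Rintegral do rewrite d1f -mulN1r.
  rewrite RintegralZl//=; last first.
    by apply: integrable_mean_normal; exact: bounded_mfun_sin.
  have ds (x : R) : is_derive x 1 (fun u => sin (t' * (u - m) + th))
      (t' * cos (t' * (x - m) + th)).
    have dl : is_derive x 1 (fun u => t' * (u - m) + th) t'.
      by apply: is_derive_eq; rewrite /GRing.scale/=; ring.
    have h := is_derive1_comp (is_derive_sin _) dl.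
    by apply: is_derive_eq; rewrite mulrC.
  rewrite (stein_normal _ _ ds).
  - under eq_Rintegral do rewrite -mulrA.
    rewrite RintegralZl//=; last first.
      by apply: integrable_bounded_normal; exact: bounded_mfun_cos.
    by rewrite mulN1r /C /f; ring.
  - exact: bounded_mfun_sin.
  - by apply: bounded_mfunM; [exact: bounded_mfun_cst|exact: bounded_mfun_cos].
  - move=> x; apply: cvgMl_tmp; apply: (cvg_comp _ cos); last exact: continuous_cos.
    apply: cvgD; last exact: cvg_cst.
    by apply: cvgMl_tmp; apply: cvgB; [exact: cvg_id|exact: cvg_cst].
pose H u := C u * expR (s ^+ 2 * u ^+ 2 / 2).
have dH (u : R) : is_derive u 1 H 0.
  have dq : is_derive u 1 (fun u => s ^+ 2 * u ^+ 2 / 2) (s ^+ 2 * u).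
    by apply: is_derive_eq; rewrite /GRing.scale/=; field.
  have h := is_derive1_comp (is_derive_expR _) dq.
  have h2 := dC u.
  by apply: is_derive_eq; rewrite /GRing.scale/=; ring.
have := is_derive_0_is_cst t 0 dH.
have -> : \int[mu]_x (cos (t * (x - m) + th) * p x) = H t * expR (- (s ^+ 2 * t ^+ 2 / 2)).
  by rewrite /H -mulrA -expRD subrr expR0 mulr1.
move=> ->; congr (_ * _); rewrite /H expr0n/= mulr0 mul0r expR0 mulr1.
rewrite /C /f; under eq_Rintegral do rewrite mul0r add0r.
rewrite RintegralZl//; last exact: integrable_normal_pdf.
by rewrite /Rintegral integral_normal_pdf mulr1.
Qed.

(** The Radon-Nikodym derivative of [normal_prob] agrees almost everywhere with the density, as both
    have the same integral over every measurable set. *)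
Lemma integral_normal_prob (f : R -> \bar R) :
  (normal_prob m s).-integrable setT f ->
  (\int[normal_prob m s]_x f x = \int[mu]_x (f x * (p x)%:E))%E.
Proof.
move=> intf; have mf := measurable_int _ intf.
rewrite -(Radon_Nikodym_change_of_variables (normal_prob_dominates m s))//=.
apply: ae_eq_integral => //.
- apply: emeasurable_funM => //; apply: (measurable_int mu).
  by apply: Radon_Nikodym_integrable; exact: normal_prob_dominates.
- apply: emeasurable_funM => //=; apply/measurableT_comp => //=.
  exact: measurable_normal_pdf.
- apply: ae_eqe_mul2l => /=.
  rewrite Radon_NikodymE//=; first exact: normal_prob_dominates.
  move=> abmu; case: cid => /= h [h1 h2 h3].
  apply: integral_ae_eq => //=.
  + by apply/measurableT_comp =>//; exact: measurable_normal_pdf.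
  + by move=> E E01 mE; rewrite -h3.
Qed.

Lemma Rintegral_normal_prob (f : R -> R) : bounded_mfun f ->
  \int[normal_prob m s]_x f x = \int[mu]_x (f x * p x).
Proof.
move=> bf; rewrite /Rintegral integral_normal_prob//.
exact: bounded_mfun_integrable.
Qed.

End normal_charfun.

(** * A centered Gaussian variable is determined by its second moment *)

Section gaussian_variable.
Context d (T : measurableType d) (R : realType) (P : probability T R).
Implicit Types X : T -> R.

Lemma gaussian_charfun X : is_gaussian P X ->
  exists m s : R, forall t th : R,
    \int[P]_w cos (t * X w + th) =
    cos (t * m + th) * expR (- (s ^+ 2 * t ^+ 2 / 2)).
Proof.
move=> [mX [m [s [s0 PX]]]]; exists m, s => t th.
pose f x := cos (t * x + th).
have mf : measurable_fun setT (fun x : R => t * x + th).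
  by apply: measurable_funD => //; exact: measurable_funM.
have bf : bounded_mfun f by exact: bounded_mfun_cos.
have mX1 : @measurable_fun _ _ T (measurableTypeR R) setT X by exact: mX.
pose mX' := @isMeasurableFun.Build _ _ T (measurableTypeR R) X mX1.
pose X' : {RV P >-> measurableTypeR R} := HB.pack X mX'.
have -> : \int[P]_w f (X w) = \int[distribution P X']_x f x.
  rewrite /Rintegral integral_distribution//=.
    by apply/measurable_EFinP; exact: bf.1.
  apply: bounded_mfun_integrable; apply: bounded_mfun_cos.
  by apply: measurable_funD => //; exact: measurable_funM.
have [s0'|s0'] := eqVneq s 0.
  have -> : \int[distribution P X']_x f x = \int[dirac (m : measurableTypeR R)]_x f x.
    congr fine; apply: eq_measure_integral => A mA _.
    by have := PX A mA; rewrite /gaussian_law s0' eqxx.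
  rewrite /Rintegral integral_dirac//; last by apply/measurable_EFinP; exact: bf.1.
  by rewrite diracT mul1e s0' expr0n/= !mul0r oppr0 expR0 mulr1.
have -> : \int[distribution P X']_x f x = \int[normal_prob m s]_x f x.
  congr fine; apply: eq_measure_integral => A mA _.
  by have := PX A mA; rewrite /gaussian_law (negbTE s0').
rewrite Rintegral_normal_prob// -(charfun_normal_pdf m s0' t (t * m + th)).
apply: eq_Rintegral => x _; by rewrite /f mulrBr addrA subrK.
Qed.

(** The parameters [m] and [s] of the law are only known to exist. Expanding the characteristic
    function at 0 identifies the second moment as [m^2 + s^2] and the mean as [m], so that for mean
    0 the characteristic function can be stated through moments alone, which the covariance
    hypothesis controls. *)
Lemma gaussian_moments X : is_gaussian P X ->
  P.-integrable setT (fun w => (X w ^+ 2)%:E) /\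
  (\int[P]_w X w = 0 -> forall th : R,
    \int[P]_w cos (X w + th) = cos th * expR (- (\int[P]_w (X w ^+ 2) / 2))).
Proof.
move=> gX; have [mX _] := gX.
have [m [s cf]] := gaussian_charfun gX.
have cE n : \int[P]_w cos (X w / n.+1%:R) =
    cos (m / n.+1%:R) * expR (- (s ^+ 2 / 2 / n.+1%:R ^+ 2)).
  transitivity (\int[P]_w cos (n.+1%:R^-1 * X w + 0)).
    by apply: eq_Rintegral => w _; rewrite addr0 mulrC.
  rewrite cf addr0 mulrC [X in cos X]mulrC exprVn mulrAC.
  by rewrite [X in _ = X]mulrC.
(* The phase [- pi / 2] turns the cosine into a sine. *)
have sE n : \int[P]_w sin (X w / n.+1%:R) =
    sin (m / n.+1%:R) * expR (- (s ^+ 2 / 2 / n.+1%:R ^+ 2)).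
  transitivity (\int[P]_w cos (n.+1%:R^-1 * X w - pi / 2)).
    by apply: eq_Rintegral => w _; rewrite cosBpihalf mulrC.
  rewrite cf cosBpihalf mulrC [X in sin X]mulrC exprVn mulrAC.
  by rewrite [X in _ = X]mulrC.
have cm0 : m / n.+1%:R @[n --> \oo] --> 0.
  by rewrite -(mulr0 m); apply: cvgMl_tmp; exact: cvg_harmonic.
have ss0 : 0 <= s ^+ 2 / 2 by rewrite divr_ge0 ?sqr_ge0.
have [|iX EX] := @moment2_charfun _ _ _ P X (m ^+ 2 + s ^+ 2) mX.
  under eq_fun do rewrite cE.
  (* The splitting [1 - c e = (1 - c) + c (1 - e)]: the first part contributes [m^2], the second
     [s^2]. *)
  have -> : (fun n : nat => 2 * n.+1%:R ^+ 2 *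
        (1 - cos (m / n.+1%:R) * expR (- (s ^+ 2 / 2 / n.+1%:R ^+ 2)))) =
      (fun n : nat => 2 * n.+1%:R ^+ 2 * (1 - cos (m / n.+1%:R)) +
        cos (m / n.+1%:R) * (2 * (n.+1%:R ^+ 2 * (1 - expR (- (s ^+ 2 / 2 / n.+1%:R ^+ 2)))))).
    by apply/funext => n; ring.
  apply: cvgD; first exact: cvg_1Bcos_harmonic.
  rewrite -[X in _ --> X]mul1r; apply: cvgM.
    by rewrite -[X in _ --> X]cos0; exact: (cvg_comp _ _ cm0 (@continuous_cos R 0)).
  rewrite [X in _ --> X](_ : _ = 2 * (s ^+ 2 / 2)); last by field.
  by apply: cvgMl_tmp; exact: cvg_1BexpR_harmonic.
split=> // EX0.
have iX1 : P.-integrable setT (EFin \o X).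
  have i1X : P.-integrable setT (fun w => (1 + X w ^+ 2)%:E).
    under eq_fun do rewrite EFinD; apply: integrableD => //.
    exact/bounded_mfun_integrable/bounded_mfun_cst.
  apply: le_integrable i1X => //; first exact/measurable_EFinP.
  move=> w _; rewrite lee_fin [leRHS]ger0_norm ?addr_ge0 ?sqr_ge0//.
  have := sqr_ge0 (`|X w| - 1); rewrite sqrrB1 real_normK ?num_real//.
  by have := normr_ge0 (X w); lra.
have m0 : m = 0.
  suff hm : n.+1%:R * \int[P]_w sin (X w / n.+1%:R) @[n --> \oo] --> m.
    by rewrite -EX0 (moment1_charfun mX iX1 hm).
  rewrite (_ : (fun n => _) = (fun n => n.+1%:R * sin (m / n.+1%:R) *
      expR (- (s ^+ 2 / 2 / n.+1%:R ^+ 2)))); last first.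
    by apply/funext => n; rewrite sE mulrA.
  have h0 : - (s ^+ 2 / 2 / n.+1%:R ^+ 2) @[n --> \oo] --> 0.
    rewrite -[X in _ --> X]oppr0; apply: cvgN.
    rewrite -[X in _ --> X](mulr0 (s ^+ 2 / 2)).
    by apply: cvgMl_tmp; exact: cvg_harmonic_sqr.
  rewrite -[X in _ --> X]mulr1; apply: cvgM; first exact: cvg_sin_harmonic.
  by rewrite -[X in _ --> X]expR0; exact: (cvg_comp _ _ h0 (@continuous_expR R 0)).
move=> th; have := cf 1 th.
rewrite m0 mulr0 add0r EX m0 expr0n/= add0r expr1n mulr1 => <-.
by apply: eq_Rintegral => w _; rewrite mul1r.
Qed.

End gaussian_variable.

(** * Bernstein approximation *)

Section bernstein.
Context (R : realType).
Implicit Types (y : R) (f g : nat -> R).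

(* Expectation of [f k] for [k] the number of successes in [n] trials of
   probability [y], i.e. a Bernstein polynomial in [y]. *)
Fixpoint bernstein y n f : R :=
  if n is n'.+1 then
    (1 - y) * bernstein y n' f + y * bernstein y n' (fun k => f k.+1)
  else f 0.

Lemma bernstein_cst y n (c : R) : bernstein y n (fun=> c) = c.
Proof. by elim: n => //= n ->; ring. Qed.

Lemma bernsteinD y n f g :
  bernstein y n (fun k => f k + g k) = bernstein y n f + bernstein y n g.
Proof. by elim: n f g => //= n ih f g; rewrite !ih; ring. Qed.

Lemma bernsteinZ y n (c : R) f :
  bernstein y n (fun k => c * f k) = c * bernstein y n f.
Proof. by elim: n f => //= n ih f; rewrite !ih; ring. Qed.

(** Variance plus squared bias of a binomial variable. The induction needs an arbitrary [a], since
    the shift of [k] replaces [a] by [a - 1]. *)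
Lemma bernstein_sqr y n (a : R) :
  bernstein y n (fun k => (k%:R - a) ^+ 2) = n%:R * (y * (1 - y)) + (n%:R * y - a) ^+ 2.
Proof.
elim: n a => [|n ih] a /=; first by ring.
rewrite ih (_ : (fun k => _) = (fun k : nat => (k%:R - (a - 1)) ^+ 2)); last first.
  by apply/funext => k; rewrite -natr1; congr (_ ^+ 2); ring.
by rewrite ih -natr1; ring.
Qed.

Lemma ler_bernstein y n f g : 0 <= y <= 1 -> (forall k, f k <= g k) ->
  bernstein y n f <= bernstein y n g.
Proof.
move=> /andP[y0 y1]; elim: n f g => //= n ih f g fg.
by rewrite lerD// ler_wpM2l ?subr_ge0// ih.
Qed.

Lemma norm_bernstein y n f (M : R) : 0 <= y <= 1 -> (forall k, `|f k| <= M) ->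
  `|bernstein y n f| <= M.
Proof.
move=> y01 fM; rewrite ler_norml -{1}(bernstein_cst y n (- M)).
rewrite -[X in _ && (_ <= X)](bernstein_cst y n M).
by rewrite !ler_bernstein// => k; have := fM k; rewrite ler_norml => /andP[].
Qed.

(** Chebyshev's argument: within [del] of [y] continuity bounds the error by [e / 2], and farther
    away the trivial bound [2 M] is at most [(2 M / del^2) (y - k / n)^2], whose binomial mean is of
    order [1 / n]. *)
Lemma cvg_bernstein (h : R -> R) y (M : R) : 0 <= y <= 1 ->
  (forall x, `|h x| <= M) -> {for y, continuous h} ->
  bernstein y n.+1 (fun k => h (k%:R / n.+1%:R)) @[n --> \oo] --> h y.
Proof.
move=> y01 hM hy.
suff near_le (e : R) : 0 < e -> \forall n \near \oo,
    `|h y - bernstein y n.+1 (fun k => h (k%:R / n.+1%:R))| <= e.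
  by apply/cvgrPdist_le => e e0; exact: near_le.
move=> e0.
have [del /= del0 hdel] : exists2 del : R, 0 < del &
    forall x, `|y - x| < del -> `|h y - h x| <= e / 2.
  have e2 : 0 < e / 2 by rewrite divr_gt0.
  move/cvgrPdist_le : hy => /(_ _ e2) [del /= del0 H].
  by exists del => // x xd; exact: H.
have M0 : 0 <= M by apply: le_trans (hM 0).
near=> n.
have n0 : 0 < n.+1%:R :> R by [].
pose B := bernstein y n.+1 (fun k => h (k%:R / n.+1%:R)).
rewrite -/B.
pose K := 2 * M / del ^+ 2.
have K0 : 0 <= K by rewrite divr_ge0 ?sqr_ge0// mulr_ge0.
pose g k : R := e / 2 + K / n.+1%:R ^+ 2 * (k%:R - n.+1%:R * y) ^+ 2.
have gB : bernstein y n.+1 g = e / 2 + K / n.+1%:R * (y * (1 - y)).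
  rewrite bernsteinD bernstein_cst bernsteinZ bernstein_sqr; congr (_ + _).
  by field; rewrite lt0r_neq0.
have hg (k : nat) : `|h y - h (k%:R / n.+1%:R)| <= g k.
  have [xd|xd] := ltP `|y - k%:R / n.+1%:R| del.
    by rewrite (le_trans (hdel _ xd))// lerDl mulr_ge0 ?sqr_ge0// divr_ge0 ?sqr_ge0.
  rewrite (le_trans (ler_normB _ _))// (le_trans (lerD (hM _) (hM _)))//.
  rewrite /g (_ : K / _ * _ = K * (y - k%:R / n.+1%:R) ^+ 2); last first.
    by field; rewrite lt0r_neq0.
  have : del ^+ 2 <= (y - k%:R / n.+1%:R) ^+ 2.
    by rewrite -[leRHS]real_normK ?num_real// ler_sqr ?nnegrE// ltW.
  move=> /(ler_wpM2l K0); rewrite {1}/K mulfVK ?expf_neq0 ?gt_eqF//.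
  by rewrite mulr2n mulrDl mul1r => /le_trans; apply; rewrite lerDr divr_ge0 ?(ltW e0).
have -> : h y - B = bernstein y n.+1 (fun k => h y + (-1) * h (k%:R / n.+1%:R)).
  by rewrite bernsteinD bernstein_cst bernsteinZ mulN1r.
have gle : bernstein y n.+1 g <= e.
  rewrite gB [leRHS](_ : e = e / 2 + e / 2); last by field.
  rewrite lerD2l.
  have : K * 2 / e <= n%:R by near: n; exact: nbhs_infty_ger.
  rewrite ler_pdivrMr// => Kn.
  have yy : y * (1 - y) <= 1.
    by move: y01 => /andP[y0 y1]; rewrite mulr_ile1 ?subr_ge0// gerBl.
  rewrite mulrAC ler_pdivrMr// (@le_trans _ _ K)//.
    by rewrite ler_piMr.
  by rewrite -(natr1 n); lra.
rewrite (le_trans _ gle)//.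
rewrite ler_norml -[X in X <= _ <= _]mulN1r -bernsteinZ !ler_bernstein// => k;
  by have := hg k; rewrite ler_norml => /andP[]; lra.
Unshelve. all: by end_near. Qed.

End bernstein.

(** * Substituting a random variable for a deterministic parameter *)

Section trig_orthogonal.
Context d (T : measurableType d) (R : realType) (P : probability T R).

Lemma bounded_mfun_bernstein (y : T -> R) n (f : nat -> T -> R) :
  bounded_mfun y -> (forall k, bounded_mfun (f k)) ->
  bounded_mfun (fun w => bernstein (y w) n (f ^~ w)).
Proof.
move=> by_; elim: n f => [|n ih] f bf /=; first exact: bf.
apply: bounded_mfunD; apply: bounded_mfunM => //; last first.
- exact: (ih (fun k => f k.+1)).
- exact: ih.
- by apply: bounded_mfunB => //; exact: bounded_mfun_cst.
Qed.

Lemma cosMcos (x y : R) : cos x * cos y = 2^-1 * cos (x + y) + 2^-1 * cos (x - y).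
Proof. by rewrite cosD cosB; field. Qed.

Variable X : T -> R.
Hypothesis mX : measurable_fun setT X.

Lemma measurable_affine (t th : R) : measurable_fun setT (fun w => t * X w + th).
Proof. by apply: measurable_funD => //; exact: measurable_funM. Qed.

(** Orthogonality to every [cos (t * X + th)] survives multiplication by [sin (a * X)], by the
    product-to-sum formulas, and the recursion defining [bernstein] only multiplies by such factors
    and adds. *)
Lemma bernstein_sin_orthogonal (a : R) n (f : nat -> T -> R) :
  (forall k, bounded_mfun (f k)) ->
  (forall k t th, \int[P]_w (f k w * cos (t * X w + th)) = 0) ->
  forall t th, \int[P]_w
    (bernstein (2^-1 + 2^-1 * sin (a * X w)) n (f ^~ w) * cos (t * X w + th)) = 0.
Proof.
elim: n f => [|n ih] f bf h t th /=; first exact: h.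
have bb (g : nat -> T -> R) : (forall k, bounded_mfun (g k)) ->
    bounded_mfun (fun w => bernstein (2^-1 + 2^-1 * sin (a * X w)) n (g ^~ w)).
  move=> bg; apply: bounded_mfun_bernstein => //.
  apply: bounded_mfunD; first exact: bounded_mfun_cst.
  apply: bounded_mfunM; first exact: bounded_mfun_cst.
  by apply: bounded_mfun_sin; exact: measurable_funM.
pose B (g : nat -> T -> R) w := bernstein (2^-1 + 2^-1 * sin (a * X w)) n (g ^~ w).
have iB (g : nat -> T -> R) t' th' : (forall k, bounded_mfun (g k)) ->
    P.-integrable setT (EFin \o (fun w => B g w * cos (t' * X w + th'))).
  move=> bg; apply: bounded_mfun_integrable; apply: bounded_mfunM; first exact: bb.
  exact/bounded_mfun_cos/measurable_affine.
pose f' k := f k.+1.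
have bf' k : bounded_mfun (f' k) by exact: bf.
pose F g c t' th' w := c * (B g w * cos (t' * X w + th')).
have iF g c t' th' : (forall k, bounded_mfun (g k)) ->
    P.-integrable setT (EFin \o F g c t' th').
  move=> bg; rewrite /F /comp; under eq_fun do rewrite EFinM.
  by apply: integrableZl => //; exact: iB.
have IF0 g c t' th' : (forall k, bounded_mfun (g k)) ->
    (forall k t th, \int[P]_w (g k w * cos (t * X w + th)) = 0) ->
    \int[P]_w F g c t' th' w = 0.
  by move=> bg hg; rewrite RintegralZl//; [rewrite ih// mulr0|exact: iB].
(* [sin u * cos v] is a combination of [cos (v + u - pi/2)] and
   [cos (v - u + pi/2)]. *)
transitivity (\int[P]_w (F f 2^-1 t th w + F f' 2^-1 t th w
   + (F f (- 4^-1) (t + a) (th - pi / 2) w + F f (- 4^-1) (t - a) (th + pi / 2) w)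
   + (F f' 4^-1 (t + a) (th - pi / 2) w + F f' 4^-1 (t - a) (th + pi / 2) w))).
  apply: eq_Rintegral => w _; rewrite /F /B.
  have -> : (t + a) * X w + (th - pi / 2) = (t * X w + th) + (a * X w - pi / 2) by ring.
  have -> : (t - a) * X w + (th + pi / 2) = (t * X w + th) - (a * X w - pi / 2) by ring.
  rewrite (cosB (t * X w + th)) (cosD (t * X w + th) (a * X w - pi / 2)) cosBpihalf /f'.
  by field.
rewrite !RintegralD//; do ?exact: iF; last 1 first.
all: try by [rewrite /comp; under eq_fun do rewrite !EFinD; do ?apply: integrableD => //; exact: iF].
rewrite !IF0// ?addr0// => k t' th'; exact: h.
Qed.

(* [L * sin (X / L)] is approximated by Bernstein polynomials in
   [(1 + sin (X / L)) / 2], and [L] is sent to infinity. *)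
Lemma trig_orthogonal_subst (Psi : R -> T -> R) (M : R) :
  (forall c, measurable_fun setT (Psi c)) -> (forall c w, `|Psi c w| <= M) ->
  (forall w, continuous (Psi ^~ w)) ->
  (forall c t th, \int[P]_w (Psi c w * cos (t * X w + th)) = 0) ->
  measurable_fun setT (fun w => Psi (X w) w) /\
  forall t th, \int[P]_w (Psi (X w) w * cos (t * X w + th)) = 0.
Proof.
move=> mPsi PsiM cPsi Psi0.
have bPsi c : bounded_mfun (Psi c) by split => //; exists M.
pose y (L : nat) w : R := 2^-1 + 2^-1 * sin (L.+1%:R^-1 * X w).
have y01 L w : 0 <= y L w <= 1.
  rewrite /y; have := sin_le1 (L.+1%:R^-1 * X w).
  by have := sin_geN1 (L.+1%:R^-1 * X w) => h1 h2; apply/andP; split; lra.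
have by_ L : bounded_mfun (y L).
  apply: bounded_mfunD; first exact: bounded_mfun_cst.
  apply: bounded_mfunM; first exact: bounded_mfun_cst.
  by apply: bounded_mfun_sin; exact: measurable_funM.
pose h (L : nat) w (x : R) := Psi (L.+1%:R * (2 * x - 1)) w.
pose u L n w := bernstein (y L w) n.+1 (fun k => h L w (k%:R / n.+1%:R)).
have bu L n : bounded_mfun (u L n).
  by apply: (@bounded_mfun_bernstein (y L) n.+1 (fun k w => h L w (k%:R / n.+1%:R))) => // k; exact: bPsi.
have uM L n w : `|u L n w| <= M by apply: norm_bernstein => // k; exact: PsiM.
pose S (L : nat) w := L.+1%:R * sin (X w / L.+1%:R).
have cu L w : u L n w @[n --> \oo] --> Psi (S L w) w.
  rewrite (_ : Psi _ w = h L w (y L w)); last first.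
    by rewrite /h /y /S (mulrC _ (X w)); congr (Psi (_ * _) _); field.
  apply: (cvg_bernstein (y01 L w)) => [x|]; first exact: PsiM.
  have lin : L.+1%:R * (2 * x - 1) @[x --> y L w] --> L.+1%:R * (2 * y L w - 1).
    apply: cvgMl_tmp; apply: cvgB; last exact: cvg_cst.
    by apply: cvgMl_tmp; exact: cvg_id.
  exact: (cvg_comp _ _ lin (cPsi w _)).
(* Joint measurability of [Psi] is not assumed: after substitution, measurability comes from the
   functions [u L n], which involve finitely many deterministic parameters, through two successive
   pointwise limits. *)
have mS L : measurable_fun setT (fun w => Psi (S L w) w).
  by apply: (measurable_fun_cvg (h := u L)) => [n|w _]; [case: (bu L n)|exact: cu].
have cS w : Psi (S L w) w @[L --> \oo] --> Psi (X w) w.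
  exact: (cvg_comp _ _ (@cvg_sin_harmonic _ (X w)) (cPsi w (X w))).
split.
  by apply: (measurable_fun_cvg (h := fun L w => Psi (S L w) w)) => // w _; exact: cS.
move=> t th; have bc : bounded_mfun (fun w => cos (t * X w + th)).
  by apply: bounded_mfun_cos; exact: measurable_affine.
have lec (c : R) w : `|c| <= M -> `|c * cos (t * X w + th)| <= M.
  by move=> cM; rewrite normrM (le_trans _ cM)// ler_piMr// cos_max.
have IS L : \int[P]_w (Psi (S L w) w * cos (t * X w + th)) = 0.
  have := @bounded_cvg_Rintegral _ _ _ P (fun n w => u L n w * cos (t * X w + th))
    (fun w => Psi (S L w) w * cos (t * X w + th)) M.
  rewrite (_ : (fun n => _) = (fun=> 0)).
    move=> /(_ _ _ _)/(cvg_unique _ (cvg_cst _)) <- //.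
    - by move=> n; apply: measurable_funM; [case: (bu L n)|case: bc].
    - by move=> n w; exact: lec.
    - by move=> w; apply: cvgMr_tmp; exact: cu.
  apply/funext => n.
  by apply: (@bernstein_sin_orthogonal L.+1%:R^-1 n.+1 (fun k w => h L w (k%:R / n.+1%:R))) => // k *; [exact: bPsi|exact: Psi0].
have := @bounded_cvg_Rintegral _ _ _ P (fun n w => Psi (S n w) w * cos (t * X w + th))
    (fun w => Psi (X w) w * cos (t * X w + th)) M.
rewrite (_ : (fun n => _) = (fun=> 0)); last by apply/funext => n; exact: IS.
move=> /(_ _ _ _)/(cvg_unique _ (cvg_cst _)) <- //.
- by move=> n; apply: measurable_funM => //; case: bc.
- by move=> n w; exact: lec.
- by move=> w; apply: cvgMr_tmp; exact: cS.
Qed.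

End trig_orthogonal.

(** * Substituting a random vector *)

Section trig_orthogonal_vector.
Context d (T : measurableType d) (R : realType) (P : probability T R).
Context (V : normedModType R) (I : finType) (G : I -> T -> R) (e : I -> V).
Hypothesis mG : forall i, measurable_fun setT (G i).

Lemma measurable_sum_affine (t : I -> R) (th : R) :
  measurable_fun setT (fun w => \sum_i t i * G i w + th).
Proof.
apply: measurable_funD => //; apply: measurable_sum => i.
exact: measurable_funM.
Qed.

(** Coordinates are substituted one at a time. The invariant keeps orthogonality to all cosines of
    the whole vector [G], including the coordinates already substituted, and an arbitrary base point
    [c], which carries the value of the next coordinate while it is still deterministic. *)
Lemma trig_orthogonal_subst_vector (Psi : V -> T -> R) (M : R) :
  (forall c, measurable_fun setT (Psi c)) -> (forall c w, `|Psi c w| <= M) ->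
  (forall w, continuous (Psi ^~ w)) ->
  (forall c (t : I -> R) th,
    \int[P]_w (Psi c w * cos (\sum_i t i * G i w + th)) = 0) ->
  measurable_fun setT (fun w => Psi (\sum_i G i w *: e i) w) /\
  \int[P]_w Psi (\sum_i G i w *: e i) w = 0.
Proof.
move=> mPsi PsiM cPsi Psi0.
have sum0 w : \sum_i (fun=> 0) i * G i w = 0 by rewrite big1// => i _; rewrite mul0r.
have main (s : seq I) (c : V) :
    measurable_fun setT (fun w => Psi (c + \sum_(i <- s) G i w *: e i) w) /\
    forall t th, \int[P]_w (Psi (c + \sum_(i <- s) G i w *: e i) w *
      cos (\sum_i t i * G i w + th)) = 0.
  elim: s c => [|j s ih] c.
    split => [|t th].
      by under eq_fun do rewrite big_nil addr0; exact: mPsi.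
    by under eq_Rintegral do rewrite big_nil addr0; exact: Psi0.
  have bs t th : bounded_mfun (fun w => cos (\sum_i t i * G i w + th)).
    by apply: bounded_mfun_cos; exact: measurable_sum_affine.
  have bPsi c' : bounded_mfun (fun w => Psi (c' + \sum_(i <- s) G i w *: e i) w).
    by split; [case: (ih c')|exists M].
  pose Phi t th u w := Psi (c + u *: e j + \sum_(i <- s) G i w *: e i) w *
    cos (\sum_i t i * G i w + th).
  have H t th := @trig_orthogonal_subst _ _ _ P (G j) (mG j) (Phi t th) M.
  have {}H t th : measurable_fun setT (fun w => Phi t th (G j w) w) /\
      forall t' th', \int[P]_w (Phi t th (G j w) w * cos (t' * G j w + th')) = 0.
    apply: H.
    - by move=> u; apply: measurable_funM; [case: (bPsi (c + u *: e j))|case: (bs t th)].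
    - move=> u w; rewrite normrM.
      by apply: (le_trans (ler_piMr _ (cos_max _))) => //; exact: PsiM.
    - move=> w u; apply: cvgMr_tmp.
      have lin : c + v *: e j + \sum_(i <- s) G i w *: e i @[v --> u] -->
          c + u *: e j + \sum_(i <- s) G i w *: e i.
        apply: cvgD; last exact: cvg_cst.
        apply: cvgD; first exact: cvg_cst.
        by apply: cvgZr_tmp; exact: cvg_id.
      exact: (cvg_comp _ _ lin (cPsi w _)).
    (* The product of the two cosines is a half sum of cosines in which [t j] is shifted by [t'] or
       [- t'], and the induction hypothesis covers both. *)
    - move=> u t' th'; rewrite /Phi.
      under eq_Rintegral do rewrite -mulrA cosMcos mulrDr !(mulrCA _ 2^-1).
      have [_ ih2] := ih (c + u *: e j).
      have add_t (r : R) w : \sum_i (t i + (i == j)%:R * r) * G i w =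
          \sum_i t i * G i w + r * G j w.
        under eq_bigr do rewrite mulrDl.
        rewrite big_split/=; congr (_ + _); rewrite (bigD1 j)//= eqxx mul1r.
        by rewrite big1 ?addr0// => i /negbTE ->; rewrite !mul0r.
      have E1 := ih2 (fun i => t i + (i == j)%:R * t') (th + th').
      have E2 := ih2 (fun i => t i + (i == j)%:R * (- t')) (th - th').
      have iE (t'' : I -> R) th'' : P.-integrable setT (EFin \o (fun w =>
          Psi (c + u *: e j + \sum_(i <- s) G i w *: e i) w *
          cos (\sum_i t'' i * G i w + th''))).
        by apply: bounded_mfun_integrable; exact: bounded_mfunM.
      under eq_Rintegral => w _.
        rewrite (_ : \sum_i t i * G i w + th + (t' * G j w + th') =
          \sum_i (t i + (i == j)%:R * t') * G i w + (th + th')); last first.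
          by rewrite add_t; ring.
        rewrite (_ : \sum_i t i * G i w + th - (t' * G j w + th') =
          \sum_i (t i + (i == j)%:R * (- t')) * G i w + (th - th')); last first.
          by rewrite add_t; ring.
        over.
      have iZ (t'' : I -> R) th'' : P.-integrable setT (EFin \o (fun w => 2^-1 *
          (Psi (c + u *: e j + \sum_(i <- s) G i w *: e i) w *
          cos (\sum_i t'' i * G i w + th'')))).
        rewrite /comp; under eq_fun do rewrite EFinM.
        by apply: integrableZl => //; exact: iE.
      rewrite RintegralD//.
      rewrite !RintegralZl//.
      by rewrite E1 E2 !mulr0 addr0.
  split=> [|t th].
    have := (H (fun=> 0) 0).1; rewrite /Phi.
    apply: eq_measurable_fun => w _.
    by rewrite sum0 addr0 cos0 mulr1 big_cons addrA.
  have := (H t th).2 0 0; rewrite /Phi.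
  under eq_Rintegral do rewrite mul0r add0r cos0 mulr1.
  move=> E0; rewrite -[RHS]E0; apply: eq_Rintegral => w _.
  by rewrite big_cons addrA.
have [m0 I0] := main (index_enum I) 0.
split; first by move: m0; under eq_fun do rewrite add0r.
have := I0 (fun=> 0) 0.
under eq_Rintegral => w _.
  rewrite add0r sum0 addr0 cos0 mulr1; over.
exact.
Qed.

End trig_orthogonal_vector.

(** * Difference quotients of the Gaussian kernel *)

Section gaussian_kernel.
Context (R : realType) (N : nat).
Implicit Types v y : 'rV[R]_N.

Definition sqnorm v : R := \sum_i v 0 i ^+ 2.

Definition gauss_kernel v : R := expR (- sqnorm v / 2).

Lemma sqnorm_ge0 v : 0 <= sqnorm v.
Proof. by apply: sumr_ge0 => i _; exact: sqr_ge0. Qed.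

Lemma enormE v : enorm v ^+ 2 = sqnorm v.
Proof. by rewrite sqr_sqrtr// sqnorm_ge0. Qed.

Lemma sqnorm0 : sqnorm 0 = 0.
Proof. by rewrite /sqnorm big1// => i _; rewrite mxE expr0n. Qed.

Lemma sqnormN v : sqnorm (- v) = sqnorm v.
Proof. by apply: eq_bigr => i _; rewrite mxE sqrrN. Qed.

Lemma sqnormZ (a : R) v : sqnorm (a *: v) = a ^+ 2 * sqnorm v.
Proof. by rewrite mulr_sumr; apply: eq_bigr => i _; rewrite mxE exprMn. Qed.

Lemma sqnormD v y : sqnorm (v + y) = sqnorm v + 2 * (\sum_i v 0 i * y 0 i) + sqnorm y.
Proof.
rewrite mulr_sumr -!big_split/=; apply: eq_bigr => i _.
by rewrite mxE sqrrD; ring.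
Qed.

Lemma sqnorm_delta i : sqnorm (delta_mx 0 i) = 1.
Proof.
rewrite /sqnorm (bigD1 i)//= mxE !eqxx expr1n big1 ?addr0// => j /negbTE ji.
by rewrite mxE ji expr0n.
Qed.

Lemma sum_delta v i : \sum_j v 0 j * (delta_mx 0 i : 'rV[R]_N) 0 j = v 0 i.
Proof.
rewrite (bigD1 i)//= mxE !eqxx mulr1 big1 ?addr0// => j /negbTE ji.
by rewrite mxE ji mulr0.
Qed.

Lemma sqnormD_delta v (u : R) i :
  sqnorm (v + u *: delta_mx 0 i) = sqnorm v + 2 * u * v 0 i + u ^+ 2.
Proof.
rewrite sqnormD sqnormZ sqnorm_delta mulr1; congr (_ + _ + _).
rewrite -mulrA; congr (_ * _); rewrite -(sum_delta v i) mulr_sumr.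
by apply: eq_bigr => j _; rewrite mxE mulrCA.
Qed.

Lemma gauss_kernel0 : gauss_kernel 0 = 1.
Proof. by rewrite /gauss_kernel sqnorm0 oppr0 mul0r expR0. Qed.

Lemma gauss_kernelN v : gauss_kernel (- v) = gauss_kernel v.
Proof. by rewrite /gauss_kernel sqnormN. Qed.

Lemma cvg_gauss_kernel_quotient v i (a : R) :
  n.+1%:R * (gauss_kernel (v + (a / n.+1%:R) *: delta_mx 0 i) - gauss_kernel v)
    @[n --> \oo] --> - a * (v 0 i * gauss_kernel v).
Proof.
pose f (u : R) := expR (- (sqnorm v + 2 * u * v 0 i + u ^+ 2) / 2).
have dq : is_derive (0 : R) 1
    (fun u : R => - (sqnorm v + 2 * u * v 0 i + u ^+ 2) / 2) (- v 0 i).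
  by apply: is_derive_eq; rewrite /GRing.scale/=; field.
have df := is_derive1_comp (is_derive_expR _) dq.
have := @cvg_harmonic_quotient1 _ _ _ a _ df.
rewrite /comp/= !mulr0 !mul0r !addr0 expr0n/= addr0.
rewrite [X in _ --> X](_ : _ = - a * (v 0 i * gauss_kernel v)); last first.
  by rewrite /gauss_kernel; ring.
apply: cvg_trans; apply: near_eq_cvg; apply: nearW => n.
by rewrite /gauss_kernel sqnormD_delta addr0.
Qed.

(** The left side is the covariance of the difference quotients of the field at one point in
    directions [i] and [j]. With [k] the kernel at a step of length [1 / n.+1], it is [n.+1^2] times
    [2 (1 - k)] when [i = j] and times [(1 - k)^2] otherwise, because the kernel factors over
    orthogonal steps; [1 - k] is of order [1 / n^2]. *)
Lemma cvg_gauss_kernel_quotient2 (i j : 'I_N) :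
  n.+1%:R * (n.+1%:R * (gauss_kernel (n.+1%:R^-1 *: delta_mx 0 i - n.+1%:R^-1 *: delta_mx 0 j)
     - gauss_kernel (n.+1%:R^-1 *: delta_mx 0 i))
   - n.+1%:R * (gauss_kernel (- (n.+1%:R^-1 *: delta_mx 0 j)) - gauss_kernel 0))
    @[n --> \oo] --> ((i == j)%:R : R).
Proof.
pose u n : R := n.+1%:R ^+ 2 * (1 - expR (- (2^-1 / n.+1%:R ^+ 2))).
have cu : u n @[n --> \oo] --> (2^-1 : R) by exact: cvg_1BexpR_harmonic.
have kE n k : gauss_kernel (n.+1%:R^-1 *: delta_mx 0 k) = expR (- (2^-1 / n.+1%:R ^+ 2)).
  by rewrite /gauss_kernel sqnormZ sqnorm_delta exprVn; congr expR; field; rewrite lt0r_neq0.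
have [<-|ij] := eqVneq i j.
  rewrite (_ : (fun n => _) = (fun n => 2 * u n)); last first.
    by apply/funext => n; rewrite subrr gauss_kernelN !kE gauss_kernel0 /u; ring.
  rewrite [X in _ --> X](_ : _ = (2 * 2^-1 : R)); last by rewrite ?eqxx divff.
  exact: (cvgMl_tmp cu).
rewrite (_ : (fun n => _) = (fun n => u n ^+ 2 * (n.+1%:R ^+ 2)^-1)).
  rewrite [X in _ --> X](_ : _ = (2^-1 : R) ^+ 2 * 0); last by rewrite mulr0.
  apply: cvgM; last exact: cvg_harmonic_sqr.
  exact: cvg_exprn.
apply/funext => n; rewrite gauss_kernelN !kE gauss_kernel0 -scaleNr.
rewrite {1}/gauss_kernel sqnormD_delta sqnormZ sqnorm_delta !mxE eqxx/= eq_sym (negbTE ij).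
rewrite mulr0 mulr0 mulr1 addr0 sqrrN exprVn.
rewrite (_ : - _ / 2 = - (2^-1 / n.+1%:R ^+ 2) + - (2^-1 / n.+1%:R ^+ 2)); last first.
  by field; rewrite lt0r_neq0.
by rewrite expRD /u; field; rewrite lt0r_neq0.
Qed.

End gaussian_kernel.

(** * Joint characteristic function of the field at a point and its gradient at [x0] *)

Section linear_combinations.
Context (R : realType) d (T : measurableType d) (P : probability T R).

Lemma integrable_sum_real (I : Type) (s : seq I) (f : I -> T -> R) :
  (forall i, P.-integrable setT (EFin \o f i)) ->
  P.-integrable setT (EFin \o (fun w => \sum_(i <- s) f i w)).
Proof.
move=> intf; elim: s => [|i s ih].
  rewrite (_ : (fun w => _) = (fun=> 0)).
    by apply: bounded_mfun_integrable; exact: bounded_mfun_cst.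
  by apply/funext => w; rewrite big_nil.
rewrite (_ : (fun w => _) = (fun w => f i w + \sum_(i <- s) f i w)).
  by rewrite /comp; under eq_fun do rewrite EFinD; apply: integrableD => //; exact: intf.
by apply/funext => w; rewrite big_cons.
Qed.

Lemma Rintegral_sum (I : Type) (s : seq I) (f : I -> T -> R) :
  (forall i, P.-integrable setT (EFin \o f i)) ->
  \int[P]_w (\sum_(i <- s) f i w) = \sum_(i <- s) \int[P]_w f i w.
Proof.
move=> intf; elim: s => [|i s ih].
  rewrite big_nil -[RHS](Rintegral_prob_cst P).
  by apply: eq_Rintegral => w _; rewrite big_nil.
under eq_Rintegral do rewrite big_cons.
by rewrite RintegralD ?ih ?big_cons//; exact: integrable_sum_real.
Qed.

Context (N : nat) (phi : 'rV[R]_N -> {RV P >-> R}).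
Hypothesis hgauss : gaussian_field P phi.
Hypothesis hcentered : centered_field P phi.
Hypothesis hcov : forall x x' : 'rV[R]_N,
  'E_P[fun w => (phi x w * phi x' w)%R]%E = (expR (- enorm (x - x') ^+ 2 / 2))%:E.

Definition lincomb (s : seq (R * 'rV[R]_N)) w := \sum_(p <- s) p.1 * phi p.2 w.

Lemma gaussian_lincomb s : is_gaussian P (lincomb s).
Proof.
rewrite (_ : lincomb s = fun w => \sum_(k < size s)
  (tnth (in_tuple s) k).1 * phi (tnth (in_tuple s) k).2 w).
  exact: hgauss.
by apply/funext => w; rewrite /lincomb big_tnth.
Qed.

Lemma integrable_field_sqr x : P.-integrable setT (fun w => (phi x w ^+ 2)%:E).
Proof.
have [+ _] := gaussian_moments (gaussian_lincomb [:: (1, x)]).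
by rewrite /lincomb; under eq_fun do rewrite big_seq1 mul1r.
Qed.

Lemma integrable_fieldM x x' :
  P.-integrable setT (EFin \o (fun w => phi x w * phi x' w)).
Proof.
have i2 : P.-integrable setT (fun w => (phi x w ^+ 2 + phi x' w ^+ 2)%:E).
  by under eq_fun do rewrite EFinD; apply: integrableD => //; exact: integrable_field_sqr.
apply: le_integrable i2 => //.
  by apply/measurable_EFinP; exact: measurable_funM.
move=> w _; rewrite lee_fin [leRHS]ger0_norm ?addr_ge0 ?sqr_ge0//.
rewrite normrM -[_ ^+ 2]real_normK ?num_real// -[phi x' w ^+ 2]real_normK ?num_real//.
have := sqr_ge0 (`|phi x w| - `|phi x' w|); rewrite sqrrB.
have : 0 <= `|phi x w| * `|phi x' w| by rewrite mulr_ge0.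
lra.
Qed.

Lemma integrable_field x : P.-integrable setT (EFin \o phi x).
Proof.
have i2 : P.-integrable setT (fun w => (1 + phi x w ^+ 2)%:E).
  under eq_fun do rewrite EFinD; apply: integrableD => //.
    exact/bounded_mfun_integrable/bounded_mfun_cst.
  exact: integrable_field_sqr.
apply: le_integrable i2 => //.
  exact/measurable_EFinP.
move=> w _; rewrite lee_fin [leRHS]ger0_norm ?addr_ge0 ?sqr_ge0//.
have := sqr_ge0 (`|phi x w| - 1); rewrite sqrrB1 real_normK ?num_real//.
by have := normr_ge0 (phi x w); lra.
Qed.

Lemma Rintegral_field x : \int[P]_w phi x w = 0.
Proof. by rewrite /Rintegral -expectation_def hcentered. Qed.

Lemma Rintegral_fieldM x x' : \int[P]_w (phi x w * phi x' w) = gauss_kernel (x - x').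
Proof.
have := hcov x x'; rewrite unlock enormE => E1.
by rewrite /Rintegral E1.
Qed.

Lemma Rintegral_lincomb s : \int[P]_w lincomb s w = 0.
Proof.
rewrite /lincomb Rintegral_sum; last first.
  move=> p; rewrite /comp; under eq_fun do rewrite EFinM.
  by apply: integrableZl => //; exact: integrable_field.
rewrite big1// => p _; rewrite RintegralZl//; last exact: integrable_field.
by rewrite Rintegral_field mulr0.
Qed.

Lemma Rintegral_lincomb_sqr s : \int[P]_w (lincomb s w ^+ 2) =
  \sum_(p <- s) p.1 * \sum_(q <- s) q.1 * gauss_kernel (p.2 - q.2).
Proof.
have iZ p q : P.-integrable setT (EFin \o fun w => p.1 * q.1 * (phi p.2 w * phi q.2 w)).
  rewrite /comp; under eq_fun do rewrite EFinM.
  by apply: integrableZl => //; exact: integrable_fieldM.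
transitivity (\int[P]_w \sum_(p <- s) \sum_(q <- s) p.1 * q.1 * (phi p.2 w * phi q.2 w)).
  apply: eq_Rintegral => w _; rewrite expr2 /lincomb mulr_suml; apply: eq_bigr => p _.
  by rewrite mulr_sumr; apply: eq_bigr => q _; rewrite mulrACA.
rewrite Rintegral_sum; last first.
  by move=> p; apply: integrable_sum_real => q; exact: iZ.
apply: eq_bigr => p _; rewrite Rintegral_sum; last by move=> q; exact: iZ.
rewrite mulr_sumr; apply: eq_bigr => q _.
rewrite RintegralZl//; last exact: integrable_fieldM.
by rewrite Rintegral_fieldM mulrA.
Qed.

Lemma lincomb_charfun s th : \int[P]_w cos (lincomb s w + th) =
  cos th * expR (- ((\sum_(p <- s) p.1 * \sum_(q <- s) q.1 * gauss_kernel (p.2 - q.2)) / 2)).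
Proof.
rewrite -Rintegral_lincomb_sqr.
have [_] := gaussian_moments (gaussian_lincomb s).
by move=> /(_ (Rintegral_lincomb s)).
Qed.

Variable x0 : 'rV[R]_N.
Hypothesis hdiff : forall w x, differentiable (sample_path phi w) x.

Let G i w := grad (sample_path phi w) x0 0 i.

(* Finite difference approximation of [sg * phi x + \sum_i t i * G i]. *)
Definition grad_lincomb (sg : R) x (t : 'I_N -> R) (n : nat) : seq (R * 'rV[R]_N) :=
  (sg, x) :: [seq (t i * n.+1%:R, n.+1%:R^-1 *: delta_mx 0 i + x0) | i <- index_enum 'I_N] ++
             [seq (- (t i * n.+1%:R), x0) | i <- index_enum 'I_N].

Lemma sum_grad_lincomb sg x t n (f : 'rV[R]_N -> R) :
  \sum_(p <- grad_lincomb sg x t n) p.1 * f p.2 =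
  sg * f x + \sum_i t i * (n.+1%:R * (f (n.+1%:R^-1 *: delta_mx 0 i + x0) - f x0)).
Proof.
rewrite /grad_lincomb big_cons big_cat !big_map/= -big_split/=; congr (_ + _).
by apply: eq_bigr => i _; ring.
Qed.

Lemma cvg_grad_quotient i w : n.+1%:R * (phi (n.+1%:R^-1 *: delta_mx 0 i + x0) w - phi x0 w)
  @[n --> \oo] --> G i w.
Proof.
rewrite /G mxE.
apply: (@cvg_harmonic_quotient _ _ (sample_path phi w) x0 (delta_mx 0 i)).
by apply: DeriveDef => //; exact: diff_derivable.
Qed.

Lemma measurable_grad i : measurable_fun setT (G i).
Proof.
apply: (measurable_fun_cvg (h := fun n w =>
  n.+1%:R * (phi (n.+1%:R^-1 *: delta_mx 0 i + x0) w - phi x0 w))) => [n|w _].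
  by apply: measurable_funM => //; exact: measurable_funB.
exact: cvg_grad_quotient.
Qed.

(** The covariance of [phi x] with [G i]: the derivative of [gauss_kernel (x - y)] in the coordinate
    [y_i], at [y = x0]. *)
Definition grad_cov x i := (x - x0) 0 i * gauss_kernel (x - x0).

(** The exponent is minus half the variance of [sg * phi x + \sum_i t i * G i]. The finite
    differences are linear combinations of the field, for which the formula is known; the left side
    passes to the limit by bounded convergence, and on the right only the double kernel sum has to
    be followed. *)
Lemma field_grad_charfun sg x (t : 'I_N -> R) th :
  \int[P]_w cos (sg * phi x w + \sum_i t i * G i w + th) =
  cos th * expR (- ((sg ^+ 2 + 2 * sg * (\sum_i t i * grad_cov x i) + \sum_i t i ^+ 2) / 2)).
Proof.
pose S n := grad_lincomb sg x t n.
have L1 : \int[P]_w cos (lincomb (S n) w + th) @[n --> \oo] -->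
    \int[P]_w cos (sg * phi x w + \sum_i t i * G i w + th).
  apply: (@bounded_cvg_Rintegral _ _ _ P (fun n w => cos (lincomb (S n) w + th)) _ 1).
  - move=> n; have [ms _] := gaussian_lincomb (S n).
    by case: (@bounded_mfun_cos _ _ _ (fun w => lincomb (S n) w + th)) => //; exact: measurable_funD.
  - by move=> n w; exact: cos_max.
  - move=> w; apply: cvg_comp; last exact: continuous_cos.
    apply: cvgD; last exact: cvg_cst.
    rewrite (_ : (fun n => _) = (fun n => sg * phi x w + \sum_i t i * (n.+1%:R *
        (phi (n.+1%:R^-1 *: delta_mx 0 i + x0) w - phi x0 w)))); last first.
      by apply/funext => n; rewrite /lincomb (sum_grad_lincomb _ _ _ _ (phi ^~ w)).
    apply: cvgD; first exact: cvg_cst.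
    by apply: cvg_sum_filter => i; apply: cvgMl_tmp; exact: cvg_grad_quotient.
suff L2 : \int[P]_w cos (lincomb (S n) w + th) @[n --> \oo] -->
    cos th * expR (- ((sg ^+ 2 + 2 * sg * (\sum_i t i * grad_cov x i) + \sum_i t i ^+ 2) / 2)).
  exact: (cvg_unique _ L1 L2).
rewrite (_ : (fun n => _) = (fun n => cos th * expR (- ((\sum_(p <- S n) p.1 *
    \sum_(q <- S n) q.1 * gauss_kernel (p.2 - q.2)) / 2)))); last first.
  by apply/funext => n; rewrite lincomb_charfun.
apply: cvgMl_tmp; apply: cvg_comp; last exact: continuous_expR.
suff : \sum_(p <- S n) p.1 * (\sum_(q <- S n) q.1 * gauss_kernel (p.2 - q.2))
    @[n --> \oo] --> sg ^+ 2 + 2 * sg * (\sum_i t i * grad_cov x i) + \sum_i t i ^+ 2.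
  by move=> h; apply: cvgN; exact: cvgMr_tmp.
pose e n i : 'rV[R]_N := n.+1%:R^-1 *: delta_mx 0 i.
pose K := @gauss_kernel R N.
(* The double sum is regrouped into the variance of [phi x], its covariances with the difference
   quotients, and the covariances of the quotients among themselves, each with a known limit. *)
rewrite (_ : (fun n => _) = (fun n =>
  sg * (sg * K (x - x) + \sum_j t j * (n.+1%:R * (K (x - (e n j + x0)) - K (x - x0)))) +
  \sum_i t i * (sg * (n.+1%:R * (K (e n i + x0 - x) - K (x0 - x))) +
    \sum_j t j * (n.+1%:R *
      (n.+1%:R * (K (e n i - e n j) - K (e n i)) - n.+1%:R * (K (- e n j) - K 0)))))); last first.
  apply/funext => n.
  have inner y := sum_grad_lincomb sg x t n (fun z => K (y - z)).
  rewrite (sum_grad_lincomb _ _ _ _ (fun y => \sum_(q <- S n) q.1 * K (y - q.2))).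
  rewrite !inner; congr (_ + _); apply: eq_bigr => i _; congr (_ * _).
  rewrite !inner opprD addrACA -sumrB mulrDr; congr (_ + _); first by ring.
  rewrite mulr_sumr; apply: eq_bigr => j _.
  rewrite -/(e n i) -/(e n j) addrK subrr.
  have -> : e n i + x0 - (e n j + x0) = e n i - e n j by rewrite opprD addrACA subrr addr0.
  have -> : x0 - (e n j + x0) = - e n j by rewrite opprD addrCA subrr addr0.
  by ring.
rewrite (_ : _ + _ = sg * (sg * K (x - x) + \sum_j t j * grad_cov x j) +
  \sum_i t i * (sg * grad_cov x i + \sum_j t j * (i == j)%:R)); last first.
  have -> : \sum_i t i * (sg * grad_cov x i + \sum_j t j * (i == j)%:R) =
      sg * (\sum_i t i * grad_cov x i) + \sum_i t i ^+ 2.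
    rewrite mulr_sumr -big_split/=; apply: eq_bigr => i _.
    rewrite (bigD1 i)//= eqxx mulr1 big1 ?addr0; first by ring.
    by move=> j; rewrite eq_sym => /negbTE ->; rewrite mulr0.
  by rewrite subrr [K 0]gauss_kernel0; ring.
have cK j : n.+1%:R * (K (x - (e n j + x0)) - K (x - x0)) @[n --> \oo] --> grad_cov x j.
  have := @cvg_gauss_kernel_quotient R N (x - x0) j (-1).
  rewrite opprK mul1r -/(grad_cov x j).
  apply: cvg_trans; apply: near_eq_cvg; apply: nearW => n.
  by rewrite opprD addrCA addrC mulN1r scaleNr.
apply: cvgD.
  apply: cvgMl_tmp; apply: cvgD; first exact: cvg_cst.
  by apply: cvg_sum_filter => j; apply: cvgMl_tmp; exact: cK.
apply: cvg_sum_filter => i; apply: cvgMl_tmp; apply: cvgD.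
  apply: cvgMl_tmp; have := cK i.
  apply: cvg_trans; apply: near_eq_cvg; apply: nearW => n.
  by rewrite /K -(gauss_kernelN (x - (e n i + x0))) -(gauss_kernelN (x - x0)) !opprB.
apply: cvg_sum_filter => j; apply: cvgMl_tmp.
exact: cvg_gauss_kernel_quotient2.
Qed.

End linear_combinations.

(** * Exchange of integrals for bounded functions *)

Section fubini_bounded.
Context (R : realType) d1 d2 (T1 : measurableType d1) (T2 : measurableType d2).
Context (P : probability T1 R) (Q : probability T2 R).

Lemma Rintegral_exchange (f : T1 -> T2 -> R) :
  bounded_mfun (fun z : T1 * T2 => f z.1 z.2) ->
  \int[P]_x \int[Q]_y f x y = \int[Q]_y \int[P]_x f x y.
Proof.
move=> bf; have [mf [M fM]] := bf.
have iPQ : (P \x Q)%E.-integrable setT (fun z : T1 * T2 => (f z.1 z.2)%:E).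
  apply: measurable_bounded_integrable => //.
    have := @product_measure1E _ _ _ _ R P Q setT setT measurableT measurableT.
    rewrite setXTT => PQ; apply: le_lt_trans (ltry 1); rewrite le_eqVlt.
    apply/orP; left; apply/eqP; apply: etrans PQ _.
    by rewrite -[RHS]mule1; congr (_ * _)%E; exact: probability_setT.
  exists M; split; first exact: num_real.
  by move=> x Mx w _ /=; rewrite (le_trans (fM w))// ltW.
have b1 x : bounded_mfun (f x).
  split; last by exists M => y; exact: (fM (x, y)).
  by have := measurableT_comp mf (measurable_pair1 x).
have b2 y : bounded_mfun (f ^~ y).
  split; last by exists M => x; exact: (fM (x, y)).
  by have := measurableT_comp mf (measurable_pair2 y).
have E1 x : (\int[Q]_y (f x y)%:E)%E = (\int[Q]_y f x y)%:E.
  rewrite /Rintegral fineK//.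
  by apply: integrable_fin_num => //; exact: bounded_mfun_integrable.
have E2 y : (\int[P]_x (f x y)%:E)%E = (\int[P]_x f x y)%:E.
  rewrite /Rintegral fineK//.
  by apply: integrable_fin_num => //; exact: bounded_mfun_integrable.
have := Fubini iPQ => /=.
under eq_integral do rewrite E1.
by under [in X in _ = X]eq_integral do rewrite E2; rewrite /Rintegral => ->.
Qed.

End fubini_bounded.

(** * Laplace transform of the squared norm of a standard Gaussian vector *)

Section gaussian_vector.
Context (R : realType) d (T : measurableType d) (P : probability T R).
Context (N : nat) (G : 'I_N -> T -> R).
Hypothesis mG : forall i, measurable_fun setT (G i).
Hypothesis charfunG : forall (t : 'I_N -> R) th,
  \int[P]_w cos (\sum_i t i * G i w + th) = cos th * expR (- ((\sum_i t i ^+ 2) / 2)).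

Let gam := normal_prob (0 : R) 1.

Lemma charfun_std_normal (t th : R) :
  \int[gam]_x cos (t * x + th) = cos th * expR (- (t ^+ 2 / 2)).
Proof.
rewrite Rintegral_normal_prob//; last first.
  by apply: bounded_mfun_cos; apply: measurable_funD.
have := @charfun_normal_pdf R 0 1 (oner_neq0 R) t th.
rewrite expr1n mul1r => <-.
by apply: eq_Rintegral => x _; rewrite subr0.
Qed.

(** The integrand times the standard density is [s] times the centered normal density of variance
    [s^2 = 1 / (1 + a)]. *)
Lemma laplace_std_normal (a : R) : 0 <= a ->
  \int[gam]_x expR (- (a * x ^+ 2 / 2)) = (Num.sqrt (1 + a))^-1.
Proof.
move=> a0; set s := (Num.sqrt (1 + a))^-1.
have s0 : 0 < s by rewrite invr_gt0 sqrtr_gt0; lra.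
have sE : 1 + a = (s ^+ 2)^-1 by rewrite -exprVn invrK sqr_sqrtr//; lra.
rewrite Rintegral_normal_prob//; last first.
  apply: bounded_mfun_expRN => [|x]; last by rewrite divr_ge0// mulr_ge0// sqr_ge0.
  by apply: measurable_funM => //; apply: measurable_funM => //; exact: measurable_funX.
have pE x : expR (- (a * x ^+ 2 / 2)) * normal_pdf 0 1 x = s * normal_pdf 0 s x.
  rewrite !normal_pdfE ?oner_neq0 ?gt_eqF// /normal_fun /normal_peak.
  rewrite mulrCA -expRD expr1n !subr0 mulrA; congr (_ * expR _).
    rewrite mul1r -mulrnAr sqrtrM ?sqr_ge0// sqrtr_sqr (gtr0_norm s0) invfM mulrA.
    by rewrite divff ?gt_eqF// mul1r.
  rewrite (_ : a = (s ^+ 2)^-1 - 1); last by rewrite -sE; ring.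
  by rewrite -(mulr_natr (s ^+ 2)); field; rewrite gt_eqF.
under eq_Rintegral do rewrite pE.
rewrite RintegralZl//; last exact: integrable_normal_pdf.
by rewrite /Rintegral integral_normal_pdf mulr1.
Qed.

(** Only the characteristic function of [G] is available, so the squares are linearized:
    [exp (- a x^2 / 2)] is the mean of [cos (b z x)] for [b^2 = a] and an auxiliary standard normal
    [z]. After an exchange of integrals each square becomes a linear term. Requiring [t] to vanish
    on [s] rules out cross terms between [t j] and the new coefficient. *)
Lemma laplace_charfun (a : R) (s : seq 'I_N) (t : 'I_N -> R) th : 0 <= a ->
  uniq s -> (forall i, i \in s -> t i = 0) ->
  \int[P]_w (\prod_(i <- s) expR (- (a * G i w ^+ 2 / 2)) * cos (\sum_i t i * G i w + th)) =
  (Num.sqrt (1 + a))^-1 ^+ size s * (cos th * expR (- ((\sum_i t i ^+ 2) / 2))).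
Proof.
move=> a0; elim: s t th => [|j s ih] t th /=.
  move=> _ _; rewrite expr0 mul1r -charfunG.
  by apply: eq_Rintegral => w _; rewrite big_nil mul1r.
move=> /andP[js us] ts.
have tj : t j = 0 by rewrite ts// mem_head.
pose b := Num.sqrt a.
have b2 : b ^+ 2 = a by rewrite sqr_sqrtr.
pose A w := \prod_(i <- s) expR (- (a * G i w ^+ 2 / 2)) * cos (\sum_i t i * G i w + th).
have bprod : bounded_mfun (fun w => \prod_(i <- s) expR (- (a * G i w ^+ 2 / 2))).
  elim: (s) => [|i s' ih'].
    under eq_fun do rewrite big_nil; exact: bounded_mfun_cst.
  under eq_fun do rewrite big_cons; apply: bounded_mfunM => //.
  apply: bounded_mfun_expRN => [|w]; last by rewrite divr_ge0// mulr_ge0// sqr_ge0.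
  by apply: measurable_funM => //; apply: measurable_funM => //; exact: measurable_funX.
have bc t' th' : bounded_mfun (fun w => cos (\sum_i t' i * G i w + th')).
  by apply: bounded_mfun_cos; exact: measurable_sum_affine.
have bA : bounded_mfun A by exact: bounded_mfunM.
transitivity (\int[P]_w \int[gam]_z (A w * cos (b * z * G j w))).
  apply: eq_Rintegral => w _; rewrite big_cons -mulrA -/(A w) mulrC.
  rewrite RintegralZl//; last first.
    apply: bounded_mfun_integrable; apply: bounded_mfun_cos.
    by apply: measurable_funM => //; exact: measurable_funM.
  congr (_ * _); have := charfun_std_normal (b * G j w) 0.
  rewrite cos0 mul1r exprMn b2 => <-.
  by apply: eq_Rintegral => z _; rewrite addr0 mulrAC.
rewrite (@Rintegral_exchange _ _ _ _ _ P gam (fun w z => A w * cos (b * z * G j w))); last first.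
  apply: bounded_mfunM.
    split; first by apply: measurableT_comp bA.1 _; exact: measurable_fst.
    by have [_ [M AM]] := bA; exists M => z; exact: AM.
  apply: bounded_mfun_cos; apply: measurable_funM.
    by apply: measurable_funM => //; exact: measurable_snd.
  by apply: measurableT_comp (mG j) _; exact: measurable_fst.
transitivity (\int[gam]_z ((Num.sqrt (1 + a))^-1 ^+ size s *
   (cos th * expR (- ((\sum_i t i ^+ 2) / 2))) * expR (- (a * z ^+ 2 / 2)))).
  apply: eq_Rintegral => z _.
  (* The product of cosines is split with [e = 1] and [e = -1]; since [t j = 0], both signs add the
     same [a * z ^+ 2] to the sum of squares. *)
  pose t' (e : R) i := t i + (i == j)%:R * (e * (b * z)).
  have t's e i : i \in s -> t' e i = 0.
    move=> si; rewrite /t' ts ?inE ?si ?orbT//.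
    case: eqVneq => [ij|_]; last by rewrite mul0r addr0.
    by move: js; rewrite -ij si.
  have t'G e w : \sum_i t' e i * G i w = \sum_i t i * G i w + e * (b * z * G j w).
    under eq_bigr do rewrite mulrDl.
    rewrite big_split/=; congr (_ + _); rewrite (bigD1 j)//= eqxx mul1r.
    by rewrite big1 ?addr0 ?mulrA// => i /negbTE ->; rewrite !mul0r.
  have t'2 e : e ^+ 2 = 1 -> \sum_i t' e i ^+ 2 = \sum_i t i ^+ 2 + a * z ^+ 2.
    move=> e1; rewrite (bigD1 j)//= [in RHS](bigD1 j)//= /t' eqxx tj.
    rewrite mul1r add0r !exprMn e1 b2 expr0n/= add0r mul1r addrC; congr (_ + _).
    by apply: eq_bigr => i /negbTE ->; rewrite mul0r addr0.
  have I e := ih (t' e) th us (@t's e).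
  have iE e : P.-integrable setT (EFin \o (fun w => \prod_(i <- s) expR (- (a * G i w ^+ 2 / 2)) *
       cos (\sum_i t' e i * G i w + th))).
    by apply: bounded_mfun_integrable; exact: bounded_mfunM.
  have iZ e : P.-integrable setT (EFin \o (fun w => 2^-1 * (\prod_(i <- s) expR (- (a * G i w ^+ 2 / 2)) *
       cos (\sum_i t' e i * G i w + th)))).
    by rewrite /comp; under eq_fun do rewrite EFinM; apply: integrableZl => //; exact: iE.
  transitivity (\int[P]_w (
     2^-1 * (\prod_(i <- s) expR (- (a * G i w ^+ 2 / 2)) * cos (\sum_i t' 1 i * G i w + th)) +
     2^-1 * (\prod_(i <- s) expR (- (a * G i w ^+ 2 / 2)) * cos (\sum_i t' (-1) i * G i w + th)))).
    apply: eq_Rintegral => w _; rewrite /A !t'G -mulrA cosMcos.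
    rewrite (addrAC _ (1 * _)) (addrAC _ (-1 * _)) mul1r mulN1r.
    by ring.
  rewrite RintegralD// !RintegralZl// !I !t'2 ?sqrrN ?expr1n//.
  by rewrite mulrDl opprD expRD; field.
rewrite RintegralZl; [|by []|].
  by rewrite laplace_std_normal// exprSr; ring.
apply: bounded_mfun_integrable; apply: bounded_mfun_expRN => [|z].
  by apply: measurable_funM => //; apply: measurable_funM => //; exact: measurable_funX.
by rewrite divr_ge0// mulr_ge0// sqr_ge0.
Qed.

Lemma laplace_sqnorm (a : R) : 0 <= a ->
  \int[P]_w expR (- (a * (\sum_i G i w ^+ 2) / 2)) = (1 + a) `^ (- (N%:R / 2)).
Proof.
move=> a0.
have s0 : \sum_(i < N) (fun=> 0 : R) i ^+ 2 = 0 by rewrite big1// => i _; rewrite expr0n.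
have := @laplace_charfun a (index_enum 'I_N) (fun=> 0) 0 a0 (index_enum_uniq _) (fun _ _ => erefl).
rewrite cos0 mul1r s0 mul0r oppr0 expR0 mulr1.
have -> : size (index_enum 'I_N) = N by rewrite -sum1_size big_const_ord iter_addn_0 mul1n.
move=> I; transitivity ((Num.sqrt (1 + a))^-1 ^+ N).
  rewrite -I; apply: eq_Rintegral => w _.
  rewrite [X in cos (X + _)]big1 => [|i _]; last by rewrite mul0r.
  rewrite addr0 cos0 mulr1 -expR_sum; congr expR.
  by rewrite mulr_sumr mulr_suml sumrN.
have a1 : 0 <= 1 + a by lra.
by rewrite powRN (mulrC N%:R) powRrM powR12_sqrt// powR_mulrn ?sqrtr_ge0// exprVn.
Qed.

End gaussian_vector.

(** * Moments read off the derivatives of a Laplace transform *)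

Section laplace_moments.
Context (R : realType) d (T : measurableType d) (P : probability T R).

(** It is the [n.+1]-th power of [u exp (- u) <= 1] at [u = c x / n.+1], itself a consequence of
    [1 + u <= exp u]. *)
Lemma exprM_expRN_le (n : nat) (c x : R) : 0 < c -> 0 <= x ->
  x ^+ n.+1 * expR (- (c * x)) <= (n.+1%:R / c) ^+ n.+1.
Proof.
move=> c0 x0.
have n0 : 0 < n.+1%:R :> R by [].
have -> : - (c * x) = n.+1%:R * - (c / n.+1%:R * x).
  by field; rewrite lt0r_neq0.
rewrite expRM_natl -exprMn lerXn2r ?nnegrE ?mulr_ge0 ?expR_ge0 ?divr_ge0 ?invr_ge0 ?(ltW c0)//.
have k0 : 0 < c / n.+1%:R by rewrite divr_gt0.
rewrite -(ler_pM2l k0) (_ : c / n.+1%:R * (n.+1%:R / c) = 1); last first.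
  by field; rewrite lt0r_neq0// gt_eqF.
rewrite mulrA expRN ler_pdivrMr ?expR_gt0// mul1r.
by rewrite (le_trans _ (expR_ge1Dx _))// lerDr.
Qed.

Variable Q : T -> R.
Hypothesis mQ : measurable_fun setT Q.
Hypothesis Q0 : forall w, 0 <= Q w.

(** Up to the factor [(- 2)^k], for [a > 0] this is the [k]-th derivative of the Laplace transform
    [laplace_moment 0]. *)
Definition laplace_moment (k : nat) (a : R) :=
  \int[P]_w (Q w ^+ k * expR (- (a * Q w / 2))).

Lemma measurable_laplace k a :
  measurable_fun setT (fun w => Q w ^+ k * expR (- (a * Q w / 2))).
Proof.
apply: measurable_funM; first exact: measurable_funX.
apply: measurableT_comp => //; apply: measurableT_comp => //.
by apply: measurable_funM => //; exact: measurable_funM.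
Qed.

Lemma laplace_le k (a b : R) w : 0 < b -> b <= a ->
  `|Q w ^+ k.+1 * expR (- (a * Q w / 2))| <= (k.+1%:R / (b / 2)) ^+ k.+1.
Proof.
move=> b0 ba; rewrite ger0_norm ?mulr_ge0 ?exprn_ge0 ?expR_ge0//.
apply: le_trans (exprM_expRN_le k (_ : 0 < b / 2) (Q0 w)); last by rewrite divr_gt0.
rewrite ler_wpM2l ?exprn_ge0// ler_expR lerN2 mulrAC.
by rewrite !(mulrAC _ _ 2^-1) ler_wpM2r// ler_wpM2r.
Qed.

Lemma bounded_laplace k (a : R) : 0 < a ->
  bounded_mfun (fun w => Q w ^+ k * expR (- (a * Q w / 2))).
Proof.
move=> a0; split; first exact: measurable_laplace.
case: k => [|k]; last by exists ((k.+1%:R / (a / 2)) ^+ k.+1) => w; exact: laplace_le.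
exists 1 => w; rewrite expr0 mul1r ger0_norm ?expR_ge0// -expR0 ler_expR oppr_le0.
by rewrite divr_ge0// mulr_ge0// ltW.
Qed.

Lemma is_derive_laplace_moment k (a : R) : 0 < a ->
  is_derive a 1 (laplace_moment k) (- laplace_moment k.+1 a / 2).
Proof.
move=> a0.
pose f (b : R) w := Q w ^+ k * expR (- (b * Q w / 2)).
have df (b : R) w : is_derive b 1 (f ^~ w) (- 2^-1 * (Q w ^+ k.+1 * expR (- (b * Q w / 2)))).
  have dl : is_derive b 1 (fun u => - (u * Q w / 2)) (- (Q w / 2)).
    by apply: is_derive_eq; rewrite /GRing.scale/=; field.
  have h := is_derive1_comp (is_derive_expR _) dl.
  have h3 : is_derive b 1 (fun=> Q w ^+ k) 0 by exact: is_derive_cst.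
  by rewrite /f; apply: is_derive_eq; rewrite /GRing.scale/= exprS; ring.
have d1f (b : R) w : partial1of2 f b w = - 2^-1 * (Q w ^+ k.+1 * expR (- (b * Q w / 2))).
  by rewrite partial1of2E; have [] := df b w.
(* On this neighbourhood the argument stays above [a / 2 > 0], so the exponential bounds every power
   of [Q] by one constant, with no moment assumption on [Q]. *)
pose I : set R := `](a / 2), (a * 2)[%classic.
have Ia : I a by rewrite /I/= in_itv/=; apply/andP; split; lra.
have I0 b : I b -> a / 2 <= b by rewrite /I/= in_itv/= => /andP[/ltW].
have a2 : 0 < a / 2 by rewrite divr_gt0.
have i1 (b : R) : I b -> P.-integrable setT (EFin \o f b).
  by move=> Ib; apply/bounded_mfun_integrable/bounded_laplace/(lt_le_trans a2)/I0.
have i2 (b : R) w : I b -> setT w -> derivable (f ^~ w) b 1.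
  by move=> _ _; have [] := df b w.
pose C : R := 2^-1 * (k.+1%:R / (a / 2 / 2)) ^+ k.+1.
have i3 (b : R) w : I b -> setT w -> `|partial1of2 f b w| <= C.
  move=> Ib _; rewrite d1f normrM normrN (@ger0_norm _ 2^-1)// ler_wpM2l//.
  by apply: laplace_le => //; exact: I0.
have C0 (w : T) : 0 <= C by rewrite mulr_ge0// exprn_ge0// divr_ge0// ltW// divr_gt0.
have iC : P.-integrable setT (EFin \o fun=> C).
  exact/bounded_mfun_integrable/bounded_mfun_cst.
have D1 := @derivable_under_integral _ _ _ P f setT measurableT a _ _ Ia i1 i2 _ C0 iC i3.
have D2 := @differentiation_under_integral _ _ _ P f setT measurableT a _ _ Ia i1 i2
  _ C0 iC i3.
apply: DeriveDef => //; rewrite -derive1E D2.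
under eq_Rintegral do rewrite d1f.
rewrite RintegralZl//; last exact/bounded_mfun_integrable/bounded_laplace.
by rewrite /laplace_moment mulNr mulrC mulNr.
Qed.

Variable r : R.
Hypothesis laplaceQ : forall a, 0 <= a ->
  \int[P]_w expR (- (a * Q w / 2)) = (1 + a) `^ r.

Lemma laplace_moment1 (a : R) : 0 < a ->
  laplace_moment 1 a = - 2 * r * (1 + a) `^ (r - 1).
Proof.
move=> a0; have [_ d1] := is_derive_laplace_moment 0 a0.
have ds : is_derive a 1 (fun u => 1 + u) 1.
  by apply: is_derive_eq; rewrite add0r; exact: mulr1.
have a1 : 0 < 1 + a by lra.
have [_ d2] := is_derive1_comp (is_derive1_powR r a1) ds.
suff : 'D_1 (laplace_moment 0) a = 'D_1 ((powR (R:=R))^~ r \o (fun u => 1 + u)) a.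
  by rewrite d1 d2; lra.
(* [laplaceQ] holds for nonnegative arguments only; agreement of the two functions near [a > 0] is
   enough to equate the derivatives. *)
apply: near_eq_derive; near=> u.
rewrite /laplace_moment/= -laplaceQ.
  by apply: eq_Rintegral => w _; rewrite expr0 mul1r.
by apply: ltW; near: u; exact: (open_nbhs_nbhs (conj (@open_gt _ 0) a0)).
Unshelve. all: by end_near. Qed.

Lemma laplace_moment2 (a : R) : 0 < a ->
  laplace_moment 2 a = 4 * r * (r - 1) * (1 + a) `^ (r - 2).
Proof.
move=> a0; have [_ d1] := is_derive_laplace_moment 1 a0.
have ds : is_derive a 1 (fun u => 1 + u) 1.
  by apply: is_derive_eq; rewrite add0r; exact: mulr1.
have a1 : 0 < 1 + a by lra.
have d2 := is_derive1_comp (is_derive1_powR (r - 1) a1) ds.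
have [_ d3] : is_derive a 1 (fun u => - 2 * r * (1 + u) `^ (r - 1))
    (- 2 * r * ((r - 1) * (1 + a) `^ (r - 1 - 1))).
  have h3 : is_derive a 1 (fun=> - 2 * r) 0 by exact: is_derive_cst.
  by apply: is_derive_eq; rewrite /GRing.scale/= ; ring.
suff : 'D_1 (laplace_moment 1) a = 'D_1 (fun u : R => - 2 * r * (1 + u) `^ (r - 1)) a.
  rewrite d1 d3 (_ : r - 1 - 1 = r - 2); last by ring.
  by set p := _ `^ _; lra.
apply: near_eq_derive; near=> u.
by apply: laplace_moment1; near: u; exact: (open_nbhs_nbhs (conj (@open_gt _ 0) a0)).
Unshelve. all: by end_near. Qed.

End laplace_moments.

(** * The value of the field after one gradient step *)

Section gradient_step.
Context (R : realType) d (T : measurableType d) (P : probability T R).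
Context (N : nat) (eta : R) (x0 : 'rV[R]_N) (phi : 'rV[R]_N -> {RV P >-> R}).
Hypothesis heta : 0 < eta.
Hypothesis hgauss : gaussian_field P phi.
Hypothesis hcentered : centered_field P phi.
Hypothesis hdiff : forall w x, differentiable (sample_path phi w) x.
Hypothesis hcov : forall x x' : 'rV[R]_N,
  'E_P[fun w => (phi x w * phi x' w)%R]%E = (expR (- enorm (x - x') ^+ 2 / 2))%:E.

Local Notation G := (fun i w => grad (sample_path phi w) x0 0 i).

Let mG i : measurable_fun setT (G i). Proof. exact: measurable_grad. Qed.

Let charfunG (t : 'I_N -> R) th :
  \int[P]_w cos (\sum_i t i * G i w + th) = cos th * expR (- ((\sum_i t i ^+ 2) / 2)).
Proof.
have := field_grad_charfun hgauss hcentered hcov x0 hdiff 0 x0 t th.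
rewrite expr0n/= mulr0 mul0r !add0r => <-.
by apply: eq_Rintegral => w _; rewrite mul0r add0r.
Qed.

Let Q w := \sum_i G i w ^+ 2.

Let mQ : measurable_fun setT Q.
Proof. by apply: measurable_sum => i; exact: measurable_funX. Qed.

Let Q_ge0 w : 0 <= Q w. Proof. by apply: sumr_ge0 => i _; exact: sqr_ge0. Qed.

(* Given the gradient [G], [phi (x0 - eta c)] is normal with mean
   [\sum_i reg c i * G i] and variance [1 - resvar c]. *)
Definition reg (c : 'rV[R]_N) i := - eta * c 0 i * gauss_kernel (eta *: c).

Definition resvar (c : 'rV[R]_N) := \sum_i reg c i ^+ 2.

Lemma regE c i : grad_cov x0 (x0 - eta *: c) i = reg c i.
Proof.
by rewrite /grad_cov addrAC subrr add0r gauss_kernelN !mxE /reg !mulNr.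
Qed.

Lemma resvarE c : resvar c = eta ^+ 2 * sqnorm c * gauss_kernel (eta *: c) ^+ 2.
Proof.
rewrite /resvar /sqnorm mulr_sumr mulr_suml; apply: eq_bigr => i _.
by rewrite /reg !exprMn sqrrN.
Qed.

(** With [u = eta^2 |c|^2] this is [u exp (- u) <= 1]. It makes the conditional variance
    nonnegative, hence keeps the exponential factor of [Psi] bounded by 1 for all [c]. *)
Lemma resvar_le1 c : resvar c <= 1.
Proof.
rewrite resvarE /gauss_kernel sqnormZ -expRM_natl.
rewrite (_ : 2 * _ = - (eta ^+ 2 * sqnorm c)); last by field.
rewrite expRN ler_pdivrMr ?expR_gt0// mul1r.
by rewrite (le_trans _ (expR_ge1Dx _))// lerDr.
Qed.

Lemma continuous_sqnorm : continuous (@sqnorm R N).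
Proof.
move=> c; apply: (@cvg_sum_filter R _ _ (nbhs c)) => i.
have h : (v : 'rV[R]_N) 0 i @[v --> c] --> c 0 i by exact: coord_continuous.
exact: (@cvg_exprn R _ (nbhs c) _ (fun v : 'rV[R]_N => v 0 i) (c 0 i) 2 h).
Qed.

Lemma continuous_reg i : continuous (reg ^~ i).
Proof.
move=> c.
have h1 : (v : 'rV[R]_N) 0 i @[v --> c] --> c 0 i by exact: coord_continuous.
have h2 : eta *: (v : 'rV[R]_N) @[v --> c] --> eta *: c.
  exact: (@scaler_continuous _ _ eta c).
have h3 : sqnorm (eta *: v) @[v --> c] --> sqnorm (eta *: c).
  exact: (cvg_comp _ _ h2 (@continuous_sqnorm (eta *: c))).
have h4 : - sqnorm (eta *: v) / 2 @[v --> c] --> - sqnorm (eta *: c) / 2.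
  exact: (cvgMr_tmp (cvgN h3)).
have h5 := cvg_comp _ _ h4 (@continuous_expR R _).
exact: (cvgM (cvgMl_tmp h1) h5).
Qed.

Let Psi (s al : R) (c : 'rV[R]_N) w : R :=
  cos (s * phi (x0 - eta *: c) w + al) -
  expR (- (s ^+ 2 * (1 - resvar c) / 2)) * cos (s * (\sum_i reg c i * G i w) + al).

Let measurable_reg c : measurable_fun setT (fun w => \sum_i reg c i * G i w).
Proof. by apply: measurable_sum => i; exact: measurable_funM. Qed.

(** By the product-to-sum formula both terms of [Psi] become cosines of linear forms in [phi x] and
    [G]. Their exponents coincide because [s^2 (1 - resvar c) + |s g + t|^2 = s^2 + 2 s (g . t) +
    |t|^2] where [g = reg c], and likewise for [- t]: [g] is at once the regression coefficient and
    the covariance with [G]. *)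
Lemma cond_charfun_orthogonal s al c (t : 'I_N -> R) th :
  \int[P]_w (Psi s al c w * cos (\sum_i t i * G i w + th)) = 0.
Proof.
set x := x0 - eta *: c.
pose E := expR (- (s ^+ 2 * (1 - resvar c) / 2)).
pose g i := reg c i.
have bS (t' : 'I_N -> R) s' th' :
    bounded_mfun (fun w => cos (s' * phi x w + \sum_i t' i * G i w + th')).
  apply: bounded_mfun_cos; apply: measurable_funD => //; apply: measurable_funD.
    exact: measurable_funM.
  by apply: measurable_sum => i; exact: measurable_funM.
have iZ (c' : R) (t' : 'I_N -> R) s' th' : P.-integrable setT
    (EFin \o fun w => c' * cos (s' * phi x w + \sum_i t' i * G i w + th')).
  apply: bounded_mfun_integrable; apply: bounded_mfunM => //.
  exact: bounded_mfun_cst.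
have I c' (t' : 'I_N -> R) s' th' :
    \int[P]_w (c' * cos (s' * phi x w + \sum_i t' i * G i w + th')) = c' * (cos th' *
      expR (- ((s' ^+ 2 + 2 * s' * (\sum_i t' i * g i) + \sum_i t' i ^+ 2) / 2))).
  rewrite RintegralZl//; last exact: bounded_mfun_integrable.
  rewrite (field_grad_charfun hgauss hcentered hcov x0 hdiff).
  by under [in LHS]eq_bigr do rewrite regE.
transitivity (\int[P]_w (
   2^-1 * cos (s * phi x w + \sum_i t i * G i w + (al + th)) +
   2^-1 * cos (s * phi x w + \sum_i (- t i) * G i w + (al - th)) +
   (- (2^-1 * E) * cos (0 * phi x w + \sum_i (s * g i + t i) * G i w + (al + th)) +
   - (2^-1 * E) * cos (0 * phi x w + \sum_i (s * g i - t i) * G i w + (al - th))))).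
  apply: eq_Rintegral => w _; rewrite /Psi -/E -/x mulrBl -mulrA !cosMcos.
  have -> : \sum_i (- t i) * G i w = - (\sum_i t i * G i w).
    by rewrite -sumrN; apply: eq_bigr => i _; rewrite mulNr.
  have -> : \sum_i (s * g i + t i) * G i w = s * (\sum_i g i * G i w) + \sum_i t i * G i w.
    rewrite mulr_sumr -big_split/=; apply: eq_bigr => i _; ring.
  have -> : \sum_i (s * g i - t i) * G i w = s * (\sum_i g i * G i w) - \sum_i t i * G i w.
    rewrite mulr_sumr -sumrB; apply: eq_bigr => i _; ring.
  set A := \sum_i t i * _; set B := \sum_i g i * _.
  rewrite mul0r !add0r /g -/B.
  have -> : s * phi x w + al + (A + th) = s * phi x w + A + (al + th) by ring.
  have -> : s * phi x w + al - (A + th) = s * phi x w - A + (al - th) by ring.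
  have -> : s * B + al + (A + th) = s * B + A + (al + th) by ring.
  have -> : s * B + al - (A + th) = s * B - A + (al - th) by ring.
  by ring.
rewrite !RintegralD//; try exact: iZ; first last.
- by rewrite /comp; under eq_fun do rewrite EFinD; apply: integrableD => //; exact: iZ.
- by rewrite /comp; under eq_fun do rewrite EFinD; apply: integrableD => //; exact: iZ.
rewrite !I !expr0n/= !mulr0 !mul0r !add0r.
set S1 := \sum_i t i * g i; set S2 := \sum_i t i ^+ 2.
have -> : \sum_i - t i * g i = - S1.
  by rewrite -sumrN; apply: eq_bigr => i _; rewrite mulNr.
have -> : \sum_i (- t i) ^+ 2 = S2 by apply: eq_bigr => i _; rewrite sqrrN.
have -> : \sum_i (s * g i + t i) ^+ 2 = s ^+ 2 * resvar c + 2 * s * S1 + S2.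
  rewrite /resvar !mulr_sumr -!big_split/=; apply: eq_bigr => i _; rewrite /g; ring.
have -> : \sum_i (s * g i - t i) ^+ 2 = s ^+ 2 * resvar c - 2 * s * S1 + S2.
  rewrite /resvar !mulr_sumr -sumrB -big_split/=; apply: eq_bigr => i _; rewrite /g; ring.
have E1 a : - (2^-1 * E) * (cos (al + th) * expR (- (a / 2))) =
    - 2^-1 * (cos (al + th) * expR (- ((s ^+ 2 * (1 - resvar c) + a) / 2))).
  by rewrite mulrDl opprD expRD /E; ring.
have E2 a : - (2^-1 * E) * (cos (al - th) * expR (- (a / 2))) =
    - 2^-1 * (cos (al - th) * expR (- ((s ^+ 2 * (1 - resvar c) + a) / 2))).
  by rewrite mulrDl opprD expRD /E; ring.
rewrite E1 E2.
have -> : s ^+ 2 * (1 - resvar c) + (s ^+ 2 * resvar c + 2 * s * S1 + S2) =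
  s ^+ 2 + 2 * s * S1 + S2 by ring.
have -> : s ^+ 2 * (1 - resvar c) + (s ^+ 2 * resvar c - 2 * s * S1 + S2) =
  s ^+ 2 + 2 * s * - S1 + S2 by ring.
by ring.
Qed.

Definition step_value w := sample_path phi w (gd_step eta (sample_path phi w) x0).

(** The expressions of [cond_mean] and [cond_var] are left unsimplified so as to display the
    integrand of [laplace_moment] with [k = 1], at [eta ^+ 2] and at [2 * eta ^+ 2] respectively. *)
Definition cond_mean w := - eta * (Q w * expR (- (eta ^+ 2 * Q w / 2))).
Definition cond_var w := 1 - eta ^+ 2 * (Q w * expR (- (2 * eta ^+ 2 * Q w / 2))).

Let gradE w : \sum_i G i w *: delta_mx 0 i = grad (sample_path phi w) x0.
Proof. by rewrite -row_sum_delta. Qed.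

Let kernel_gradE w : gauss_kernel (eta *: grad (sample_path phi w) x0) =
  expR (- (eta ^+ 2 * Q w / 2)).
Proof. by rewrite /gauss_kernel sqnormZ mulNr. Qed.

Let cond_meanE w :
  \sum_i reg (grad (sample_path phi w) x0) i * G i w = cond_mean w.
Proof.
rewrite /cond_mean; set E := expR _; rewrite /Q mulr_suml mulr_sumr.
by apply: eq_bigr => i _; rewrite /reg kernel_gradE -/E; ring.
Qed.

Let cond_varE w : 1 - resvar (grad (sample_path phi w) x0) = cond_var w.
Proof.
rewrite resvarE kernel_gradE /cond_var -expRM_natl mulrA.
by congr (_ - _ * expR _); field.
Qed.

Let e2 : 0 < eta ^+ 2. Proof. by rewrite exprn_gt0. Qed.

Let e22 : 0 < 2 * eta ^+ 2. Proof. by rewrite mulr_gt0. Qed.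

Let bounded_cond_mean : bounded_mfun cond_mean.
Proof.
apply: bounded_mfunM; first exact: bounded_mfun_cst.
exact: (bounded_laplace mQ Q_ge0 1 e2).
Qed.

Let bounded_cond_var : bounded_mfun cond_var.
Proof.
apply: bounded_mfunB; first exact: bounded_mfun_cst.
apply: bounded_mfunM; first exact: bounded_mfun_cst.
exact: (bounded_laplace mQ Q_ge0 1 e22).
Qed.

Let cond_var_ge0 w : 0 <= cond_var w.
Proof. by rewrite -cond_varE subr_ge0 resvar_le1. Qed.


Lemma step_value_charfun s al :
  measurable_fun setT (fun w => cos (s * step_value w + al)) /\
  \int[P]_w cos (s * step_value w + al) =
  \int[P]_w (expR (- (s ^+ 2 * cond_var w / 2)) * cos (s * cond_mean w + al)).
Proof.
have le1 c : expR (- (s ^+ 2 * (1 - resvar c) / 2)) <= 1.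
  rewrite -[leRHS]expR0 ler_expR oppr_le0 divr_ge0// mulr_ge0 ?sqr_ge0//.
  by rewrite subr_ge0 resvar_le1.
(* The bound 2 adds up the two terms of [Psi], each at most 1 in absolute value. *)
have [| | | |mPsi IPsi] := @trig_orthogonal_subst_vector _ _ R P _ _
    (fun i w => G i w) (fun i => delta_mx 0 i) mG (Psi s al) 2.
- move=> c; apply: measurable_funB.
    case: (@bounded_mfun_cos _ _ _ (fun w => s * phi (x0 - eta *: c) w + al)) => //.
    by apply: measurable_funD => //; exact: measurable_funM.
  apply: measurable_funM => //.
  case: (@bounded_mfun_cos _ _ _ (fun w => s * (\sum_i reg c i * G i w) + al)) => //.
  by apply: measurable_funD => //; exact: measurable_funM.
- move=> c w; rewrite (le_trans (ler_normB _ _))// [leRHS](_ : _ = 1 + 1)// lerD ?cos_max//.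
  by rewrite normrM ger0_norm ?expR_ge0// mulr_ile1 ?expR_ge0 ?cos_max.
- move=> w c.
  have h1 : x0 - eta *: v @[v --> c] --> x0 - eta *: c.
    exact: (cvgB (cvg_cst x0) (@scaler_continuous _ _ eta c)).
  have cphi : {for x0 - eta *: c, continuous (sample_path phi w)}.
    by apply: differentiable_continuous; exact: hdiff.
  have h2 := cvg_comp _ _ h1 cphi.
  have h3 : s * phi (x0 - eta *: v) w + al @[v --> c] --> s * phi (x0 - eta *: c) w + al.
    exact: (cvgD (cvgMl_tmp h2) (cvg_cst al)).
  have h4 := cvg_comp _ _ h3 (@continuous_cos R _).
  have r1 i := @continuous_reg i c.
  have h5 : resvar v @[v --> c] --> resvar c.
    apply: (@cvg_sum_filter R _ _ (nbhs c)) => i.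
    exact: (@cvg_exprn R _ (nbhs c) _ (fun v => reg v i) (reg c i) 2 (r1 i)).
  have h6 : - (s ^+ 2 * (1 - resvar v) / 2) @[v --> c] -->
      - (s ^+ 2 * (1 - resvar c) / 2).
    exact: (cvgN (cvgMr_tmp (cvgMl_tmp (cvgB (cvg_cst _) h5)))).
  have h7 := cvg_comp _ _ h6 (@continuous_expR R _).
  have h8 : \sum_i reg v i * G i w @[v --> c] --> \sum_i reg c i * G i w.
    by apply: (@cvg_sum_filter R _ _ (nbhs c)) => i; exact: (cvgMr_tmp (r1 i)).
  have h9 : s * (\sum_i reg v i * G i w) + al @[v --> c] -->
      s * (\sum_i reg c i * G i w) + al.
    exact: (cvgD (cvgMl_tmp h8) (cvg_cst al)).
  have h10 := cvg_comp _ _ h9 (@continuous_cos R _).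
  exact: (cvgB h4 (cvgM h7 h10)).
- by move=> c t th; exact: cond_charfun_orthogonal.
have PsiE w : Psi s al (\sum_i G i w *: delta_mx 0 i) w =
    cos (s * step_value w + al) -
    expR (- (s ^+ 2 * cond_var w / 2)) * cos (s * cond_mean w + al).
  by rewrite gradE /Psi cond_varE cond_meanE.
have bE : bounded_mfun (fun w => expR (- (s ^+ 2 * cond_var w / 2)) * cos (s * cond_mean w + al)).
  apply: bounded_mfunM.
    apply: bounded_mfun_expRN => [|w]; last by rewrite divr_ge0// mulr_ge0// sqr_ge0.
    by apply: measurable_funM => //; apply: measurable_funM => //; case: bounded_cond_var.
  apply: bounded_mfun_cos; apply: measurable_funD => //.
  by apply: measurable_funM => //; case: bounded_cond_mean.
have mc : measurable_fun setT (fun w => cos (s * step_value w + al)).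
  rewrite (_ : (fun w => _) = (fun w => Psi s al (\sum_i G i w *: delta_mx 0 i) w +
      expR (- (s ^+ 2 * cond_var w / 2)) * cos (s * cond_mean w + al))).
    by apply: measurable_funD => //; case: bE.
  by apply/funext => w; rewrite PsiE subrK.
split=> //; apply/eqP; rewrite -subr_eq0 -RintegralB//.
- by rewrite -[X in _ == X]IPsi; apply/eqP/eq_Rintegral => w _; rewrite PsiE.
- apply: bounded_mfun_integrable; split => //.
  by exists 1 => w; exact: cos_max.
- exact: bounded_mfun_integrable.
Qed.

(** Only cosines of [step_value] are known to be measurable so far; the phase [- pi / 2] gives
    sines, and [n sin (y / n)] tends to [y]. *)
Lemma measurable_step_value : measurable_fun setT step_value.
Proof.
apply: (measurable_fun_cvg (h := fun n w => n.+1%:R * sin (step_value w / n.+1%:R)))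
  => [n|w _]; last exact: cvg_sin_harmonic.
apply: measurable_funM => //.
have [+ _] := step_value_charfun n.+1%:R^-1 (- (pi / 2)).
by under eq_fun do rewrite cosBpihalf mulrC.
Qed.

(** The second difference at 0 of the characteristic function is the mean of [f n], which converges
    boundedly to conditional variance plus squared conditional mean. *)
Lemma step_value_moment2 :
  P.-integrable setT (fun w => (step_value w ^+ 2)%:E) /\
  \int[P]_w (step_value w ^+ 2) = \int[P]_w (cond_var w + cond_mean w ^+ 2).
Proof.
apply: moment2_charfun; first exact: measurable_step_value.
pose f (n : nat) w := 2 * n.+1%:R ^+ 2 *
  (1 - expR (- (cond_var w / 2 / n.+1%:R ^+ 2)) * cos (cond_mean w / n.+1%:R)).
have fE n w : f n w = 2 * n.+1%:R ^+ 2 * (1 - cos (cond_mean w / n.+1%:R)) +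
    cos (cond_mean w / n.+1%:R) *
    (2 * (n.+1%:R ^+ 2 * (1 - expR (- (cond_var w / 2 / n.+1%:R ^+ 2))))).
  by rewrite /f; ring.
have bc n : bounded_mfun (fun w =>
    expR (- (cond_var w / 2 / n.+1%:R ^+ 2)) * cos (cond_mean w / n.+1%:R)).
  apply: bounded_mfunM.
    apply: bounded_mfun_expRN => [|w]; last by rewrite !divr_ge0// sqr_ge0.
    by apply: measurable_funM => //; apply: measurable_funM => //; case: bounded_cond_var.
  by apply: bounded_mfun_cos; apply: measurable_funM => //; case: bounded_cond_mean.
have IE n : 2 * n.+1%:R ^+ 2 * (1 - \int[P]_w cos (step_value w / n.+1%:R)) =
    \int[P]_w f n w.
  have [_] := step_value_charfun n.+1%:R^-1 0.
  rewrite (_ : \int[P]_w cos (n.+1%:R^-1 * _ + _) = \int[P]_w cos (step_value w / n.+1%:R)); last first.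
    by apply: eq_Rintegral => w _; rewrite addr0 mulrC.
  move=> ->; rewrite /f RintegralZl//; last first.
    by apply: bounded_mfun_integrable; apply: bounded_mfunB => //; exact: bounded_mfun_cst.
  rewrite RintegralB//; [|exact/bounded_mfun_integrable/bounded_mfun_cst|exact: bounded_mfun_integrable].
  rewrite Rintegral_prob_cst; congr (_ * (_ - _)); apply: eq_Rintegral => w _.
  rewrite addr0 (mulrC _ (cond_mean w)); congr (expR _ * _).
  by rewrite exprVn; field; rewrite lt0r_neq0.
rewrite (_ : (fun n => _) = (fun n => \int[P]_w f n w)); last by apply/funext => n; exact: IE.
have [mm [M Mm]] := bounded_cond_mean.
(* In the splitting [fE], [M ^+ 2] bounds the cosine part, and 1 the exponential part because
   [cond_var w <= 1]. *)
apply: (@bounded_cvg_Rintegral _ _ _ P f _ (M ^+ 2 + 1)).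
- move=> n; apply: measurable_funM => //.
  by apply: measurable_funB => //; case: (bc n).
- move=> n w; rewrite fE (le_trans (ler_normD _ _))// lerD//.
    have /andP[h0 h1] := le_1Bcos_harmonic (cond_mean w) n.
    rewrite ger0_norm// (le_trans h1)// -real_normK ?num_real//.
    by rewrite lerXn2r ?nnegrE// (le_trans _ (Mm w)).
  rewrite normrM mulr_ile1// ?cos_max//.
  have n0 : 0 < n.+1%:R ^+ 2 :> R by rewrite exprn_gt0.
  have u0 : 0 <= cond_var w / 2 / n.+1%:R ^+ 2 by rewrite !divr_ge0// ltW.
  have u1 : n.+1%:R ^+ 2 * (cond_var w / 2 / n.+1%:R ^+ 2) = cond_var w / 2.
    by field; rewrite lt0r_neq0.
  have v1 : cond_var w <= 1.
    by rewrite -cond_varE gerBl; apply: sumr_ge0 => i _; exact: sqr_ge0.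
  rewrite ger0_norm; last first.
    rewrite mulr_ge0// mulr_ge0 ?(ltW n0)// subr_ge0 -[leRHS]expR0 ler_expR.
    by rewrite oppr_le0.
  have : n.+1%:R ^+ 2 * (1 - expR (- (cond_var w / 2 / n.+1%:R ^+ 2))) <= cond_var w / 2.
    rewrite -[leRHS]u1 ler_wpM2l ?(ltW n0)// lerBlDr addrC -lerBlDr.
    exact: expR_ge1Dx.
  lra.
- move=> w; rewrite [X in _ --> X]addrC.
  rewrite (_ : (fun n => _) = (fun n => 2 * n.+1%:R ^+ 2 * (1 - cos (cond_mean w / n.+1%:R)) +
    cos (cond_mean w / n.+1%:R) *
    (2 * (n.+1%:R ^+ 2 * (1 - expR (- (cond_var w / 2 / n.+1%:R ^+ 2))))))); last first.
    by apply/funext => n; exact: fE.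
  apply: cvgD; first exact: cvg_1Bcos_harmonic.
  have cm0 : cond_mean w / n.+1%:R @[n --> \oo] --> 0.
    by rewrite -(mulr0 (cond_mean w)); apply: cvgMl_tmp; exact: cvg_harmonic.
  rewrite -[X in _ --> X]mul1r; apply: cvgM.
    by rewrite -[X in _ --> X]cos0; exact: (cvg_comp _ _ cm0 (@continuous_cos R 0)).
  rewrite [X in _ --> X](_ : _ = 2 * (cond_var w / 2)); last by field.
  by apply: cvgMl_tmp; apply: cvg_1BexpR_harmonic; rewrite divr_ge0.
Qed.

Lemma integrable_step_value : P.-integrable setT (EFin \o step_value).
Proof.
have [i2 _] := step_value_moment2.
have i3 : P.-integrable setT (fun w => (1 + step_value w ^+ 2)%:E).
  under eq_fun do rewrite EFinD; apply: integrableD => //.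
  exact/bounded_mfun_integrable/bounded_mfun_cst.
apply: le_integrable i3 => //.
  by apply/measurable_EFinP; exact: measurable_step_value.
move=> w _; rewrite lee_fin [leRHS]ger0_norm ?addr_ge0 ?sqr_ge0//.
have := sqr_ge0 (`|step_value w| - 1); rewrite sqrrB1 real_normK ?num_real//.
by have := normr_ge0 (step_value w); lra.
Qed.

Lemma step_value_moment1 : \int[P]_w step_value w = \int[P]_w cond_mean w.
Proof.
apply: moment1_charfun; [exact: measurable_step_value|exact: integrable_step_value|].
pose f (n : nat) w := expR (- (cond_var w / 2 / n.+1%:R ^+ 2)) *
  (n.+1%:R * sin (cond_mean w / n.+1%:R)).
have bE n : bounded_mfun (fun w => expR (- (cond_var w / 2 / n.+1%:R ^+ 2))).
  apply: bounded_mfun_expRN => [|w]; last by rewrite !divr_ge0// sqr_ge0.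
  by apply: measurable_funM => //; apply: measurable_funM => //; case: bounded_cond_var.
have bs n : bounded_mfun (fun w => sin (cond_mean w / n.+1%:R)).
  by apply: bounded_mfun_sin; apply: measurable_funM => //; case: bounded_cond_mean.
have IE n : n.+1%:R * \int[P]_w sin (step_value w / n.+1%:R) = \int[P]_w f n w.
  have [_] := step_value_charfun n.+1%:R^-1 (- (pi / 2)).
  rewrite (_ : \int[P]_w cos (n.+1%:R^-1 * _ + _) = \int[P]_w sin (step_value w / n.+1%:R)); last first.
    by apply: eq_Rintegral => w _; rewrite cosBpihalf mulrC.
  move=> ->; transitivity (n.+1%:R * \int[P]_w
      (expR (- (cond_var w / 2 / n.+1%:R ^+ 2)) * sin (cond_mean w / n.+1%:R))).
    congr (_ * _); apply: eq_Rintegral => w _.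
    rewrite cosBpihalf (mulrC _ (cond_mean w)); congr (expR _ * _).
    by rewrite exprVn; field; rewrite lt0r_neq0.
  rewrite -RintegralZl//; last by apply: bounded_mfun_integrable; exact: bounded_mfunM.
  by apply: eq_Rintegral => w _; rewrite /f mulrCA.
rewrite (_ : (fun n => _) = (fun n => \int[P]_w f n w)); last by apply/funext => n; exact: IE.
have [mm [M Mm]] := bounded_cond_mean.
apply: (@bounded_cvg_Rintegral _ _ _ P f _ M).
- move=> n; apply: measurable_funM; first by case: (bE n).
  by apply: measurable_funM => //; case: (bs n).
- move=> n w; rewrite /f normrM ger0_norm ?expR_ge0//.
  have E1 : expR (- (cond_var w / 2 / n.+1%:R ^+ 2)) <= 1.
    by rewrite -[leRHS]expR0 ler_expR oppr_le0 !divr_ge0// sqr_ge0.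
  rewrite (le_trans (ler_piMl _ E1))//.
  rewrite normrM (le_trans (ler_wpM2l _ (norm_sin_le _)))//.
  by rewrite normrM normfV mulrCA (@ger0_norm _ n.+1%:R)// divff// mulr1.
- move=> w; rewrite -[X in _ --> X]mul1r; apply: cvgM; last exact: cvg_sin_harmonic.
  have h0 : - (cond_var w / 2 / n.+1%:R ^+ 2) @[n --> \oo] --> 0.
    rewrite -[X in _ --> X]oppr0; apply: cvgN.
    rewrite -[X in _ --> X](mulr0 (cond_var w / 2)).
    by apply: cvgMl_tmp; exact: cvg_harmonic_sqr.
  by rewrite -[X in _ --> X]expR0; exact: (cvg_comp _ _ h0 (@continuous_expR R 0)).
Qed.

Let laplaceQ (a : R) : 0 <= a ->
  \int[P]_w expR (- (a * Q w / 2)) = (1 + a) `^ (- (N%:R / 2)).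
Proof. exact: (laplace_sqnorm mG charfunG). Qed.

(** The first Laplace moment at [eta^2] with [r = - N / 2], so that [- 2 r = N]. *)
Lemma Rintegral_step_value :
  \int[P]_w step_value w = - (N%:R * eta * (eta ^+ 2 + 1) `^ (- (N%:R / 2) - 1)).
Proof.
rewrite step_value_moment1 /cond_mean RintegralZl//; last first.
  by apply: bounded_mfun_integrable; exact: (bounded_laplace mQ Q_ge0 1 e2).
have := laplace_moment1 mQ Q_ge0 laplaceQ e2; rewrite /laplace_moment => ->.
by rewrite (addrC 1); field.
Qed.

(** At [2 eta^2] the first two Laplace moments are [N (1 + 2 eta^2) p] and [N (N + 2) p] with
    [p = (1 + 2 eta^2)^(- N / 2 - 2)], and their difference explains the factor
    [N + 1 - 2 eta^2]. *)
Lemma Rintegral_step_value_sqr : \int[P]_w (step_value w ^+ 2) =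
  1 + N%:R * eta ^+ 2 * (1 + 2 * eta ^+ 2) `^ (- (N%:R / 2) - 2)
    * (N%:R + 1 - 2 * eta ^+ 2).
Proof.
have [_ ->] := step_value_moment2.
have b1 := bounded_laplace mQ Q_ge0 1 e22.
have b2 := bounded_laplace mQ Q_ge0 2 e22.
have i1 := bounded_mfun_integrable P b1.
have i2 := bounded_mfun_integrable P b2.
have m1 := laplace_moment1 mQ Q_ge0 laplaceQ e22.
have m2 := laplace_moment2 mQ Q_ge0 laplaceQ e22.
transitivity (\int[P]_w (1 +
   (- eta ^+ 2 * (Q w ^+ 1 * expR (- (2 * eta ^+ 2 * Q w / 2))) +
   eta ^+ 2 * (Q w ^+ 2 * expR (- (2 * eta ^+ 2 * Q w / 2)))))).
  apply: eq_Rintegral => w _; rewrite /cond_var /cond_mean.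
  rewrite (_ : - (2 * _ * _ / 2) = 2 * - (eta ^+ 2 * Q w / 2)); last by field.
  by rewrite expRM_natl; ring.
have iZ c k : P.-integrable setT (EFin \o fun w =>
    c * (Q w ^+ k * expR (- (2 * eta ^+ 2 * Q w / 2)))).
  rewrite /comp; under eq_fun do rewrite EFinM; apply: integrableZl => //.
  exact: (bounded_mfun_integrable P (bounded_laplace mQ Q_ge0 k e22)).
rewrite RintegralD//; first last.
- by rewrite /comp; under eq_fun do rewrite EFinD; apply: integrableD => //; exact: iZ.
- exact/bounded_mfun_integrable/bounded_mfun_cst.
rewrite Rintegral_prob_cst RintegralD//.
rewrite !RintegralZl// -/(laplace_moment P Q 1 _) -/(laplace_moment P Q 2 _) m1 m2.
have s0 : 0 < 1 + 2 * eta ^+ 2 by rewrite addr_gt0.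
have powS : (1 + 2 * eta ^+ 2) `^ (- (N%:R / 2) - 1) =
    (1 + 2 * eta ^+ 2) `^ (- (N%:R / 2) - 2) * (1 + 2 * eta ^+ 2).
  have -> : - (N%:R / 2) - 1 = - (N%:R / 2) - 2 + 1 :> R by ring.
  rewrite (@powRD _ _ (- (N%:R / 2) - 2)); last by rewrite (gt_eqF s0) implybT.
  by rewrite powRr1 // ltW.
by rewrite powS; field.
Qed.

End gradient_step.

Unset Implicit Arguments.

Theorem mainTheorem2 (R : realType) (d : measure_display)
    (T : measurableType d) (P : probability T R)
    (N : nat) (hN : (1 <= N)%N) (eta : R) (heta : 0 < eta) (x0 : 'rV[R]_N)
    (phi : 'rV[R]_N -> {RV P >-> R})
    (hgauss : gaussian_field P phi)
    (hcentered : centered_field P phi)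
    (hC1 : forall w : T, continuously_differentiable (sample_path phi w))
    (hcov : forall x x' : 'rV[R]_N,
      'E_P[fun w => (phi x w * phi x' w)%R]%E =
      (expR (- enorm (x - x') ^+ 2 / 2))%:E) :
  let x1 := fun w : T => gd_step eta (sample_path phi w) x0 in
  let Phi1 := fun w : T => sample_path phi w (x1 w) in
  'E_P[Phi1]%E =
    (- (N%:R * eta * (eta ^+ 2 + 1) `^ (- (N%:R / 2) - 1)))%:E /\
  'V_P[Phi1]%E =
    (1 + N%:R * eta ^+ 2 * (1 + 2 * eta ^+ 2) `^ (- (N%:R / 2) - 2)
           * (N%:R + 1 - 2 * eta ^+ 2)
       - N%:R ^+ 2 * eta ^+ 2 * (eta ^+ 2 + 1) `^ (- N%:R - 2))%:E.
Proof.
move=> x1 Phi1.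
have hdiff w x : differentiable (sample_path phi w) x by case: (hC1 w).
have iPhi : P.-integrable setT (EFin \o Phi1).
  exact: (integrable_step_value x0 heta hgauss hcentered hdiff hcov).
have [iPhi2 _] := step_value_moment2 x0 heta hgauss hcentered hdiff hcov.
have E1 : 'E_P[Phi1]%E = (- (N%:R * eta * (eta ^+ 2 + 1) `^ (- (N%:R / 2) - 1)))%:E.
  rewrite -(Rintegral_step_value x0 heta hgauss hcentered hdiff hcov) unlock.
  by rewrite /Rintegral fineK//; exact: integrable_fin_num.
split=> //.
have l1 : Phi1 \in Lfun P 1 by apply/Lfun1_integrable.
have l2 : (Phi1 * Phi1)%R \in Lfun P 1 by apply/Lfun1_integrable.
rewrite /variance covarianceE//.
rewrite E1.
have -> : 'E_P[Phi1 * Phi1]%E = (\int[P]_w (step_value eta x0 phi w ^+ 2))%:E.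
  by rewrite unlock /Rintegral fineK//; exact: integrable_fin_num.
rewrite (Rintegral_step_value_sqr x0 heta hgauss hcentered hdiff hcov) -EFinM -EFinB.
congr EFin; congr (_ - _).
have s0 : 0 <= eta ^+ 2 + 1 by rewrite addr_ge0 ?sqr_ge0.
(* The exponent is twice that of the expectation, so the last term of the variance is the square of
   the mean. *)
have -> : - N%:R - 2 = (- (N%:R / 2) - 1) * 2%:R :> R by field.
rewrite powRrM powR_mulrn ?powR_ge0//; ring.
Qed.
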